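(* Let $H$ be a Hilbert space (of any finite or infinite dimension) and let $K\subseteq\mathbb{C}^d$ be a compact convex set. If $T=(T_1,\ldots,T_d)$ is a tuple of compact operators on $H$ with $\mathcal{W}(T)=\mathcal{W}^{\min}(K)$, then every nonzero extreme point of $K$ is a joint eigenvalue for $T$, and the set $\mathrm{ext}(K)$ of extreme points of $K$ is either a finite set or a sequence tending to zero.
   Context: Let $\mathcal{M}^d=\bigcup_{n\ge1}M_n^d$, where $M_n^d$ is the set of $d$-tuples of complex $n\times n$ matrices. UCP means unital completely positive. For $T\in\mathcal{B}(H)^d$, the matrix range is $\mathcal{W}(T)=\bigcup_n\mathcal{W}_n(T)$, where $\mathcal{W}_n(T)=\{(\psi(T_1),\ldots,\psi(T_d)):\psi:\mathcal{B}(H)\to M_n\text{ UCP}\}$. A tuple of operators is normal if its members are normal and commute with each other; $\sigma(N)$ denotes the joint spectrum of a normal tuple. $Y\in\mathcal{B}(L)^d$ is a dilation of $X\in\mathcal{B}(H)^d$ if there is an isometry $V:H\to L$ with $X_i=V^*Y_iV$ for all $i$. For a compact convex set $K\subseteq\mathbb{C}^d$, $\mathcal{W}^{\min}(K)$ is the set of $X\in\mathcal{M}^d$ having a normal dilation $N$ with $\sigma(N)\subseteq K$. A point $\lambda\in\mathbb{C}^d$ is a joint eigenvalue of $T$ if there is a nonzero $v\in H$ with $T_iv=\lambda_iv$ for all $i$. *)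

(* Defs.v *)
From HB Require Import structures.
From mathcomp Require Import all_boot all_order all_algebra.
From mathcomp Require Import sesquilinear complex.
From mathcomp Require Import all_classical all_reals all_analysis.
Set Implicit Arguments.
Unset Strict Implicit.
Unset Printing Implicit Defensive.
Import Order.TTheory GRing.Theory Num.Theory.
Import numFieldNormedType.Exports.
Local Open Scope classical_set_scope.
Local Open Scope complex_scope.
Local Open Scope ring_scope.

(* Scalars are R[i] for R : realType.  Its order is partial: [0 <= z] says that
   z is real and nonnegative, and norms take their values in R[i].  The library
   puts the metric topology on R[i]^o only; it is transported to R[i] here. *)
HB.instance Definition _ (R : realType) := NormedModule.copy R[i] R[i]^o.

(* Linear in the first argument.  Positive definiteness and the completeness of
   the inner product norm come from [dot_normE] and CompleteNormedModule. *)
HB.mixin Record CompleteNormedModule_isHilbert (R : realType) H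
    & CompleteNormedModule R[i] H := {
  dot : {dot H for @Num.conj R[i]} ;
  dot_normE : forall x : H, dot x x = `|x| ^+ 2
}.

#[short(type="hilbertType")]
HB.structure Definition Hilbert (R : realType) :=
  {H of CompleteNormedModule R[i] H & CompleteNormedModule_isHilbert R H}.

Definition cdot (R : realType) (n : nat) (x y : 'cV[R[i]]_n) : R[i] :=
  \sum_(i < n) x i 0 * (y i 0)^*%C.

(* B is the adjoint A^* of A, with respect to the inner products e and f. *)
Definition is_adjoint (R : realType) (E F : Type)
    (e : E -> E -> R[i]) (f : F -> F -> R[i]) (A : E -> F) (B : F -> E) :=
  forall x y, f (A x) y = e x (B y).

Section Operators.
Variables (R : realType) (H : hilbertType R).
Implicit Types (A B : H -> H) (S : set (H -> H)).

Definition bounded_op : set (H -> H) := [set A | linear A /\ continuous A].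

Definition compact_op : set (H -> H) :=
  [set A | bounded_op A /\ precompact (A @` [set x | `|x| <= 1])].

Definition normal_op : set (H -> H) :=
  [set A | bounded_op A /\
    exists B, [/\ bounded_op B, is_adjoint (@dot R H) (@dot R H) A B
                & A \o B = B \o A]].

Definition unital_cstar_subalgebra S :=
  [/\ S `<=` bounded_op,
      S id,
      forall (a : R[i]) A B, S A -> S B -> S (a *: A + B),
      forall A B, S A -> S B -> S (A \o B)
   &  (forall A B, S A -> bounded_op B ->
         is_adjoint (@dot R H) (@dot R H) A B -> S B) /\
      (* closed in operator norm *)
      (forall A, bounded_op A ->
         (forall eps : R[i], 0 < eps -> exists2 B, S B &
            forall x, `|A x - B x| <= eps * `|x|) -> S A)].

Definition character S (chi : (H -> H) -> R[i]) :=
  [/\ chi id = 1,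
      forall (a : R[i]) A B, S A -> S B -> chi (a *: A + B) = a * chi A + chi B
   &  forall A B, S A -> S B -> chi (A \o B) = chi A * chi B].

Section Tuples.
Variables (d : nat) (T : 'I_d -> H -> H).

Definition normal_tuple :=
  (forall i, normal_op (T i)) /\ (forall i j, T i \o T j = T j \o T i).

Definition generated_cstar : set (H -> H) :=
  smallest unital_cstar_subalgebra (range T).

(* The image of the maximal ideal space of the unital C*-algebra generated
   by T under chi |-> (chi (T_1), ..., chi (T_d)); used for normal tuples. *)
Definition joint_spectrum : set 'rV[R[i]]_d :=
  [set la | exists2 chi, character generated_cstar chi &
                         forall i, chi (T i) = la 0 i].

Definition joint_eigenvalue (la : 'rV[R[i]]_d) :=
  exists2 v : H, v != 0 & forall i, T i v = la 0 i *: v.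

End Tuples.

Definition completely_positive (n : nat) (psi : (H -> H) -> 'M[R[i]]_n) :=
  forall (k : nat) (A : 'I_k -> 'I_k -> H -> H),
    (forall i j, bounded_op (A i j)) ->
    (forall x : 'I_k -> H, 0 <= \sum_i \sum_j dot (A i j (x j)) (x i)) ->
    forall x : 'I_k -> 'cV[R[i]]_n,
      0 <= \sum_i \sum_j cdot (psi (A i j) *m x j) (x i).

(* psi represents a map B(H) -> M_n; its values off [bounded_op] are junk. *)
Definition ucp (n : nat) (psi : (H -> H) -> 'M[R[i]]_n) :=
  [/\ forall (a : R[i]) A B, bounded_op A -> bounded_op B ->
        psi (a *: A + B) = a *: psi A + psi B,
      psi id = 1%:M
   &  completely_positive psi].

Definition matrix_range (d : nat) (T : 'I_d -> H -> H) (n : nat) :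
    set ('I_d -> 'M[R[i]]_n) :=
  [set X | exists2 psi, ucp psi & forall i, X i = psi (T i)].

(* Y is a dilation of X: X_i = V^* Y_i V for an isometry V : C^n -> H. *)
Definition is_dilation (d n : nat)
    (Y : 'I_d -> H -> H) (X : 'I_d -> 'M[R[i]]_n) :=
  exists (V : 'cV[R[i]]_n -> H) (Vs : H -> 'cV[R[i]]_n),
    [/\ linear V,
        forall x y, dot (V x) (V y) = cdot x y,
        is_adjoint (@cdot R n) (@dot R H) V Vs
     &  forall i x, X i *m x = Vs (Y i (V x))].

End Operators.

Arguments matrix_range {R H d} T n.

Definition wmin (R : realType) (d : nat) (K : set 'rV[R[i]]_d) (n : nat) :
    set ('I_d -> 'M[R[i]]_n) :=
  [set X | exists (L : hilbertType R) (N : 'I_d -> L -> L),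
     [/\ normal_tuple N, joint_spectrum N `<=` K & is_dilation N X]].

Arguments wmin {R d} K n.

(* [0 < t < 1] in the order of R[i] forces t to be real. *)
Definition extreme_points (R : realType) (d : nat) (K : set 'rV[R[i]]_d) :
    set 'rV[R[i]]_d :=
  [set x | K x /\
    forall y z (t : R[i]), K y -> K z -> 0 < t < 1 ->
      x = t *: y + (1 - t) *: z -> y = x /\ z = x].

(* Main.v *)
(* Let la be an extreme point of K.  For every eps there is a real-affine F with
   |z - la|^2 <= F z on K and F la < eps.  For a commuting normal tuple N with joint
   spectrum in K this inequality passes to the operators:
   |(N_i - la_i) u|^2 <= F (<N_j u, u>)_j for unit vectors u, the same bound holding for
   the adjoints.  Compressing T to the span of two vectors x and y gives an element of
   W(T) = W^min(K), hence a normal dilation, so that |<(T_i - la_i) x, y>|^2 is at most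
   |y|^2 F (<T_j x, x>)_j.  As la is the value at T of a state of B(H), some unit x has
   F (<T_j x, x>)_j < eps: thus la is a joint approximate eigenvalue of T, and a genuine
   one when la <> 0, since T is compact.  The bound for adjoints makes eigenvectors of
   distinct extreme points orthogonal, so by compactness only finitely many extreme
   points lie outside a given neighbourhood of 0.

   The operator inequality needs no spectral theorem.  If it failed, a self-adjoint
   polynomial S in N and its adjoints would take a positive value <S u, u>.  By Fuglede's
   theorem all these operators commute, so maximizing their numerical ranges one after
   the other, starting with S, yields unit vectors that are approximate eigenvectors of
   all of them with a positive value for S.  Limits along these vectors define a character
   of the C*-algebra generated by N, that is a point of the joint spectrum at which the
   scalar inequality fails. *)
Require Import Defs.
From HB Require Import structures.
From mathcomp Require Import all_boot all_order all_algebra.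
From mathcomp Require Import cyclic separable cyclotomic.
From mathcomp Require Import sesquilinear complex.
From mathcomp Require Import all_classical all_reals all_analysis.
From mathcomp Require Import zify ring lra.
Import Order.TTheory GRing.Theory Num.Theory.
Import numFieldNormedType.Exports.
Local Open Scope classical_set_scope.
Local Open Scope complex_scope.
Local Open Scope ring_scope.
Set Implicit Arguments.
Unset Strict Implicit.
Unset Printing Implicit Defensive.
Local Notation Re := complex.Re.
Local Notation Im := complex.Im.

(** * Complex numbers and Hilbert spaces over them *)

Section ComplexParts.
Variable R : realType.
Implicit Types (a b : R[i]) (r : R).

Lemma ReD a b : Re (a + b) = Re a + Re b. Proof. by case: a b => [? ?] [? ?]. Qed.
Lemma ImD a b : Im (a + b) = Im a + Im b. Proof. by case: a b => [? ?] [? ?]. Qed.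
Lemma ReN a : Re (- a) = - Re a. Proof. by case: a. Qed.
Lemma ImN a : Im (- a) = - Im a. Proof. by case: a. Qed.
Lemma ReB a b : Re (a - b) = Re a - Re b. Proof. by rewrite ReD ReN. Qed.
Lemma ImB a b : Im (a - b) = Im a - Im b. Proof. by rewrite ImD ImN. Qed.
Lemma Re_mul a b : Re (a * b) = Re a * Re b - Im a * Im b.
Proof. by case: a b => [? ?] [? ?]. Qed.
Lemma Im_mul a b : Im (a * b) = Re a * Im b + Im a * Re b.
Proof. by case: a b => [? ?] [? ?]. Qed.
Lemma ReJ a : Re a^* = Re a. Proof. by case: a. Qed.
Lemma ImJ a : Im a^* = - Im a. Proof. by case: a. Qed.
Lemma Re_real r : Re r%:C = r. Proof. by []. Qed.
Lemma Im_real r : Im r%:C = 0. Proof. by []. Qed.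
Lemma Re_realM r a : Re (r%:C * a) = r * Re a.
Proof. by rewrite Re_mul/= mul0r subr0. Qed.
Lemma complex_eqP a b : Re a = Re b -> Im a = Im b -> a = b.
Proof. by case: a b => [? ?] [? ?] /= -> ->. Qed.
Lemma conjcE a : a^*%C = a^*. Proof. by []. Qed.
Lemma conj_realE r : r%:C^* = r%:C. Proof. by rewrite -conjcE conjc_real. Qed.
Lemma Re_sum I (s : seq I) (P : pred I) (F : I -> R[i]) :
  Re (\sum_(i <- s | P i) F i) = \sum_(i <- s | P i) Re (F i).
Proof. exact: (big_morph _ ReD erefl). Qed.

Definition absc a : R := Num.sqrt (Re a ^+ 2 + Im a ^+ 2).
Lemma normcEabs a : `|a| = (absc a)%:C. Proof. exact: normc_def. Qed.
Lemma absc_sqr a : absc a ^+ 2 = Re a ^+ 2 + Im a ^+ 2.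
Proof. by rewrite sqr_sqrtr// addr_ge0// sqr_ge0. Qed.
Lemma absc_ge0 a : 0 <= absc a. Proof. exact: sqrtr_ge0. Qed.
Lemma absc_mulJ a : a * a^* = (absc a ^+ 2)%:C.
Proof.
apply: complex_eqP; rewrite ?Re_mul ?Im_mul ReJ ImJ /= ?absc_sqr; ring.
Qed.
Lemma Re_le_absc a : `|Re a| <= absc a.
Proof. by rewrite -sqrtr_sqr ler_wsqrtr// lerDl sqr_ge0. Qed.
Lemma Im_le_absc a : `|Im a| <= absc a.
Proof. by rewrite -sqrtr_sqr ler_wsqrtr// lerDr sqr_ge0. Qed.
Lemma gt0_complexE (e : R[i]) : 0 < e -> e = (Re e)%:C /\ 0 < Re e.
Proof. by case: e => x y; rewrite ltcE/= => /andP[/eqP -> ->]. Qed.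

End ComplexParts.

Section HilbertNorm.
Variables (R : realType) (H : hilbertType R).
Implicit Types (x y z : H) (a b : R[i]) (r s : R).

Lemma dotDl x y z : dot (x + y) z = dot x z + dot y z.
Proof. exact: linearDl. Qed.
Lemma dotDr x y z : dot x (y + z) = dot x y + dot x z.
Proof. exact: linearDr. Qed.
Lemma dotZl a x y : dot (a *: x) y = a * dot x y.
Proof. exact: linearZl_LR. Qed.
Lemma dotZr a x y : dot x (a *: y) = a^* * dot x y.
Proof. by rewrite linearZr_LR. Qed.
Lemma dotC x y : dot x y = (dot y x)^*.
Proof. by rewrite hermC /= expr0 mul1r. Qed.
Lemma dotNl x y : dot (- x) y = - dot x y. Proof. exact: linearNl. Qed.
Lemma dotNr x y : dot x (- y) = - dot x y. Proof. exact: linearNr. Qed.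
Lemma dotBl x y z : dot (x - y) z = dot x z - dot y z. Proof. exact: linearBl. Qed.
Lemma dotBr x y z : dot x (y - z) = dot x y - dot x z. Proof. exact: linearBr. Qed.
Lemma dot0l x : dot 0 x = 0 :> R[i]. Proof. exact: linear0l. Qed.
Lemma dot0r x : dot x 0 = 0 :> R[i]. Proof. exact: linear0r. Qed.
Lemma dot_suml I (s : seq I) (P : pred I) (F : I -> H) y :
  dot (\sum_(i <- s | P i) F i) y = \sum_(i <- s | P i) dot (F i) y.
Proof. exact: linear_sumlz. Qed.
Lemma dot_sumr I (s : seq I) (P : pred I) (F : I -> H) y :
  dot y (\sum_(i <- s | P i) F i) = \sum_(i <- s | P i) dot y (F i).
Proof. exact: linear_sumr. Qed.

Definition rdot x y : R := Re (dot x y).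
Definition nrm x : R := Num.sqrt (rdot x x).

Lemma rdotDl x y z : rdot (x + y) z = rdot x z + rdot y z.
Proof. by rewrite /rdot dotDl ReD. Qed.
Lemma rdotDr x y z : rdot x (y + z) = rdot x y + rdot x z.
Proof. by rewrite /rdot dotDr ReD. Qed.
Lemma rdotBl x y z : rdot (x - y) z = rdot x z - rdot y z.
Proof. by rewrite /rdot dotBl ReB. Qed.
Lemma rdotBr x y z : rdot x (y - z) = rdot x y - rdot x z.
Proof. by rewrite /rdot dotBr ReB. Qed.
Lemma rdotNl x y : rdot (- x) y = - rdot x y.
Proof. by rewrite /rdot dotNl ReN. Qed.
Lemma rdotNr x y : rdot x (- y) = - rdot x y.
Proof. by rewrite /rdot dotNr ReN. Qed.
Lemma rdotZl r x y : rdot (r%:C *: x) y = r * rdot x y.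
Proof. by rewrite /rdot dotZl Re_realM. Qed.
Lemma rdotZr r x y : rdot x (r%:C *: y) = r * rdot x y.
Proof. by rewrite /rdot dotZr -conjcE conjc_real Re_realM. Qed.
Lemma rdotC x y : rdot x y = rdot y x.
Proof. by rewrite /rdot dotC ReJ. Qed.
Lemma rdot0l x : rdot 0 x = 0. Proof. by rewrite /rdot dot0l. Qed.

Definition rdotE := (rdotDl, rdotDr, rdotBl, rdotBr, rdotNl, rdotNr, rdotZl, rdotZr).

Lemma dotxx x : dot x x = (rdot x x)%:C.
Proof.
have /ger0_Im : (0 : R[i]) <= dot x x by rewrite dot_normE exprn_ge0.
by move=> i0; apply: complex_eqP.
Qed.
Lemma rdot_ge0 x : 0 <= rdot x x.
Proof. by rewrite -lecR -dotxx dot_normE exprn_ge0. Qed.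
Lemma nrm_sqr x : nrm x ^+ 2 = rdot x x.
Proof. by rewrite sqr_sqrtr// rdot_ge0. Qed.
Lemma nrm_ge0 x : 0 <= nrm x. Proof. exact: sqrtr_ge0. Qed.
Lemma normE x : `|x| = (nrm x)%:C.
Proof.
apply/eqP; rewrite -(@eqrXn2 _ 2)// ?lecR ?nrm_ge0//.
by rewrite -dot_normE -rmorphXn/= nrm_sqr dotxx.
Qed.
Lemma nrm_eq0 x : (nrm x == 0) = (x == 0).
Proof. by rewrite -[RHS]normr_eq0 normE eq_complex /= eqxx andbT. Qed.
Lemma nrm0 : nrm 0 = 0. Proof. by apply/eqP; rewrite nrm_eq0. Qed.
Lemma nrm_gt0 x : (0 < nrm x) = (x != 0).
Proof. by rewrite lt_neqAle nrm_ge0 andbT eq_sym nrm_eq0. Qed.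
Lemma nrmD x y : nrm (x + y) <= nrm x + nrm y.
Proof. by rewrite -lecR rmorphD/= -!normE ler_normD. Qed.
Lemma nrmZ a x : nrm (a *: x) = absc a * nrm x.
Proof. by apply: (@complexI R); rewrite rmorphM/= -!normE -normcEabs normrZ. Qed.
Lemma nrmN x : nrm (- x) = nrm x.
Proof. by apply: (@complexI R); rewrite -!normE normrN. Qed.
Lemma absc_real r : absc r%:C = `|r|.
Proof. by rewrite /absc /= expr0n addr0 sqrtr_sqr. Qed.
Lemma nrm_unit x : x != 0 -> nrm ((nrm x)^-1%:C *: x) = 1.
Proof.
move=> x0; rewrite nrmZ absc_real ger0_norm ?invr_ge0 ?nrm_ge0//.
by rewrite mulVf// nrm_eq0.
Qed.

Lemma rdot_CS x y : rdot x y <= nrm x * nrm y.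
Proof.
have [->|y0] := eqVneq y 0; first by rewrite /rdot dot0r nrm0 mulr0.
have ny : 0 < nrm y by rewrite nrm_gt0.
have := rdot_ge0 ((nrm y)%:C *: x - (nrm x)%:C *: y).
rewrite !rdotE (rdotC y x) -!nrm_sqr => h.
have [x0|x0] := eqVneq x 0; first by rewrite x0 rdot0l nrm0 mul0r.
have nx : 0 < nrm x by rewrite nrm_gt0.
rewrite -(ler_pM2l (mulr_gt0 nx ny)); nra.
Qed.

Lemma dot_CS x y : absc (dot x y) <= nrm x * nrm y.
Proof.
set d := dot x y; have [->|d0] := eqVneq (absc d) 0.
  by rewrite mulr_ge0// nrm_ge0.
have dp : 0 < absc d by rewrite lt_neqAle eq_sym d0 absc_ge0.
have := rdot_CS (d^* *: x) y; rewrite nrmZ.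
have -> : rdot (d^* *: x) y = absc d ^+ 2.
  by rewrite /rdot dotZl -/d mulrC absc_mulJ.
have -> : absc d^* = absc d by rewrite /absc ReJ ImJ sqrrN.
by rewrite expr2 -mulrA ler_pM2l.
Qed.

Lemma dot_inj x y : (forall z, dot z x = dot z y) -> x = y.
Proof.
move=> h; apply/eqP; rewrite -subr_eq0 -nrm_eq0 -[_ == _](@sqrf_eq0 R) nrm_sqr.
by rewrite /rdot dotBr h subrr.
Qed.

Lemma nrm_cvgP (T : Type) (F : set_system T) (u : T -> H) (l : H) : Filter F ->
  (u x @[x --> F] --> l) <-> (forall e : R, 0 < e -> \forall x \near F, nrm (l - u x) < e).
Proof.
move=> FF; split=> [/cvgrPdist_lt h e e0|h].
  have /h : 0 < e%:C by rewrite ltcR.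
  by apply: filterS => x; rewrite normE ltcR.
apply/cvgrPdist_lt => e /gt0_complexE[-> e0].
by apply: filterS (h _ e0) => x; rewrite normE ltcR.
Qed.

End HilbertNorm.

Section Operators.
Variables (R : realType) (H : hilbertType R).
Implicit Types (A B : H -> H).

Lemma linD A : linear A -> {morph A : x y / x + y}.
Proof. by move=> lA x y; rewrite -{1}[x]scale1r lA scale1r. Qed.
Lemma lin0 A : linear A -> A 0 = 0.
Proof. by move=> lA; apply: (addrI (A 0)); rewrite -linD// !addr0. Qed.
Lemma linZ A : linear A -> forall a x, A (a *: x) = a *: A x.
Proof. by move=> lA a x; rewrite -[a *: x]addr0 lA lin0// addr0. Qed.
Lemma linN A : linear A -> {morph A : x / - x}.
Proof. by move=> lA x; rewrite -scaleN1r linZ// scaleN1r. Qed.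
Lemma linB A : linear A -> {morph A : x y / x - y}.
Proof. by move=> lA x y; rewrite linD// linN. Qed.

Definition opbound (c : R) A := forall x, nrm (A x) <= c * nrm x.

Lemma bounded_opP A :
  bounded_op A <-> linear A /\ exists2 c, 0 < c & opbound c A.
Proof.
split=> [[lA cA]|[lA [c c0 bA]]]; split=> //.
  have lA1 : GRing.linear_for *:%R A by [].
  pose fA := GRing.isLinear.Build R[i] H H *:%R A lA1.
  pose f : {linear H -> H} := HB.pack A fA.
  have /linear_boundedP : bounded_near f (nbhs 0).
    by apply/continuous_linear_bounded; exact: cA.
  move=> /pinfty_ex_gt0[M M0 hM].
  have [ME Mp] := gt0_complexE M0; exists (Re M) => // x.
  by have := hM x; rewrite !normE ME -rmorphM/= lecR.
move=> x; apply/nrm_cvgP => e e0; near=> y.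
rewrite -linB//; apply: le_lt_trans (bA _) _.
rewrite mulrC -ltr_pdivlMr//; near: y.
have /nrm_cvgP : y @[y --> nbhs x] --> x by apply: cvg_id.
by apply; rewrite divr_gt0.
Unshelve. all: by end_near. Qed.

End Operators.

(** * Riesz representation and adjoints *)

Lemma invSn_lt (R : realType) (e : R) : 0 < e ->
  exists N, forall n, (N <= n)%N -> n.+1%:R^-1 < e.
Proof.
move=> e0; exists (Num.truncn e^-1) => n Nn.
rewrite invf_plt ?posrE ?ltr0n//.
by apply: lt_le_trans (truncnS_gt _) _; rewrite ler_nat ltnS.
Qed.

Section Riesz.
Variables (R : realType) (H : hilbertType R).
Implicit Types (x y z : H).

Lemma nrm_cauchy (u : nat -> H) :
  (forall e, 0 < e -> exists N, forall n k, (N <= n)%N -> (N <= k)%N -> nrm (u n - u k) < e) ->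
  exists l, forall e, 0 < e -> exists N, forall n, (N <= n)%N -> nrm (l - u n) < e.
Proof.
move=> cu; have : cvg (u @ \oo).
  apply/cauchy_cvgP/cauchy_exP => e /gt0_complexE[-> e0].
  have [N hN] := cu _ e0; exists (u N); exists N => // n /= Nn.
  by rewrite -ball_normE /= normE ltcR; exact: hN.
move=> /cvg_ex[l /nrm_cvgP ul]; exists l => e /ul[N _ hN].
by exists N => n Nn; exact: hN.
Qed.

(** A minimizing sequence of [J x = |x|^2 - 2 Re (g x)] is Cauchy by the parallelogram identity
    [par], and its limit represents [Re g]. Replacing [x] by [i x] recovers the imaginary part. *)
Lemma Riesz_representation (g : H -> R[i]) (c : R) :
  (forall (a : R[i]) x y, g (a *: x + y) = a * g x + g y) ->
  (forall x, absc (g x) <= c * nrm x) ->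
  exists y, forall x, g x = dot x y.
Proof.
move=> lg bg.
have gD x y : g (x + y) = g x + g y by rewrite -{1}[x]scale1r lg mul1r.
have g0 : g 0 = 0 by apply: (addrI (g 0)); rewrite -gD !addr0.
have gZ (a : R[i]) x : g (a *: x) = a * g x by rewrite -[a *: x]addr0 lg g0 addr0.
pose q x := Re (g x).
have qD x y : q (x + y) = q x + q y by rewrite /q gD ReD.
have qZ (r : R) x : q (r%:C *: x) = r * q x by rewrite /q gZ Re_realM.
have qb x : q x <= c * nrm x.
  by apply: le_trans (bg x); apply: le_trans (Re_le_absc _); exact: ler_norm.
pose J x := rdot x x - 2 * q x.
have Jlb x : - c ^+ 2 <= J x.
  by rewrite /J -nrm_sqr; have := qb x; have := sqr_ge0 (nrm x - c); nra.
have infJ : has_inf (range J).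
  by split; [exists (J 0); exists 0|exists (- c ^+ 2) => _ [x _ <-]].
set m := inf (range J).
have Jm x : m <= J x by apply: ge_inf; [exact: infJ.2|exists x].
have /choice[u hu] : forall n : nat, exists x, J x < m + n.+1%:R^-1.
  move=> n; have [|_ [x _ <-] hx] := @inf_adherent _ (range J) n.+1%:R^-1 _ infJ.
    by rewrite invr_gt0 ltr0n.
  by exists x.
have par x y : rdot (x - y) (x - y) =
    2 * J x + 2 * J y - 4 * J (2^-1%:C *: (x + y)).
  by rewrite /J qZ qD !rdotE (rdotC y x); field.
have [|y hy] := @nrm_cauchy u.
  move=> e e0; have [|N hN] := @invSn_lt R (e ^+ 2 / 4).
    by rewrite divr_gt0// exprn_gt0.
  exists N => n k Nn Nk; rewrite -(@ltr_pXn2r _ 2)// ?nnegrE ?nrm_ge0 ?ltW//.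
  have arith (a b M p' q' E : R) : a < m + p' -> b < m + q' -> p' < E / 4 ->
    q' < E / 4 -> m <= M -> 2 * a + 2 * b - 4 * M < E by lra.
  by rewrite nrm_sqr par; exact: arith (hu n) (hu k) (hN _ Nn) (hN _ Nk) (Jm _).
have qE x : q x = rdot x y.
  apply/eqP; rewrite -subr_eq0; apply/eqP; set d := q x - rdot x y.
  (* Minimality of [m] is tested at [u n + t x] and [n] is sent to infinity. Below, [t = d / |x|^2]
     forces [d = 0]. *)
  have var t : 2 * t * d <= t ^+ 2 * rdot x x.
    apply/ler_addgt0Pr => e e0.
    have [|N1 h1] := @invSn_lt R (e / 2); first by rewrite divr_gt0.
    have k0 : 0 < 2 * (`|t| + 1) * (nrm x + 1).
      by rewrite !mulr_gt0// ?ltr_wpDl ?nrm_ge0.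
    have [|N2 h2] := hy (e / 2 / (2 * (`|t| + 1) * (nrm x + 1))).
      by rewrite !divr_gt0.
    pose n := maxn N1 N2.
    have l1 := h1 n (leq_maxl _ _); have l2 := h2 n (leq_maxr _ _).
    have := Jm (u n + t%:C *: x); rewrite /J qD qZ !rdotE (rdotC x (u n)) => J1.
    have := hu n; rewrite /J => J2.
    have J3 : 2 * t * (q x - rdot (u n) x) <= t ^+ 2 * rdot x x + e / 2.
      by move: J1 J2 l1; set p' := _^-1; lra.
    have dE : 2 * t * d = 2 * t * (q x - rdot (u n) x) - 2 * (t * rdot (y - u n) x).
      by rewrite /d rdotBl (rdotC x y); ring.
    suff : `|t * rdot (y - u n) x| <= e / 4.
      by rewrite dE ler_norml => /andP[+ _]; lra.
    rewrite normrM.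
    have cs : `|rdot (y - u n) x| <= nrm (y - u n) * nrm x.
      by apply: le_trans (Re_le_absc _) _; exact: dot_CS.
    rewrite ltr_pdivlMr// in l2.
    have tp := normr_ge0 t; have xp := nrm_ge0 x; have yp := nrm_ge0 (y - u n).
    have := normr_ge0 (rdot (y - u n) x).
    move: cs l2; set A := `|rdot _ _|; set B := nrm (y - _); set X := nrm x; set T := `|t|.
    move=> cs l2 A0; have tA : T * A <= T * (B * X) by rewrite ler_wpM2l.
    have : T * (B * X) <= B * ((T + 1) * (X + 1)).
      by rewrite mulrCA ler_wpM2l// ler_pM// lerDl.
    nra.
  have [x0|x0] := eqVneq (rdot x x) 0.
    by have := var d; rewrite x0; nra.
  have xp : 0 < rdot x x by rewrite lt_neqAle eq_sym x0 rdot_ge0.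
  have := var (d / rdot x x).
  have -> : (d / rdot x x) ^+ 2 * rdot x x = d ^+ 2 / rdot x x by field.
  have -> : 2 * (d / rdot x x) * d = 2 * (d ^+ 2 / rdot x x) by field.
  move=> h; have : d ^+ 2 / rdot x x <= 0 by lra.
  rewrite pmulr_lle0 ?invr_gt0// => d0.
  by apply/eqP; rewrite -[_ == _](@sqrf_eq0 R) eq_le d0 sqr_ge0.
exists y => x; apply: complex_eqP; first exact: qE.
have := qE ('i%C *: x); rewrite /q /rdot gZ dotZl !Re_mul /= !mul0r !mul1r !sub0r.
exact: oppr_inj.
Qed.

Lemma adjoint_exists (A : H -> H) : bounded_op A ->
  exists B, bounded_op B /\ is_adjoint (@dot R H) (@dot R H) A B.
Proof.
move=> /bounded_opP[lA [c c0 bA]].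
have /choice[B hB] : forall y, exists z, forall x, dot (A x) y = dot x z.
  move=> y; apply: (@Riesz_representation _ (c * nrm y)) => [a x z|x].
    by rewrite lA dotDl dotZl.
  apply: le_trans (dot_CS _ _) _.
  by rewrite mulrAC ler_wpM2r ?nrm_ge0.
exists B; split; last by move=> x y; exact: hB.
apply/bounded_opP; split=> [a x y|].
  by apply: dot_inj => z; rewrite -hB !dotDr !dotZr !hB.
exists c => // y; have [->|By0] := eqVneq (B y) 0.
  by rewrite nrm0 mulr_ge0 ?nrm_ge0 ?ltW.
have Bp : 0 < nrm (B y) by rewrite nrm_gt0.
(* [|B y|^2 = <A (B y), y>], and one factor [|B y|] cancels. *)
rewrite -(ler_pM2l Bp) -expr2 nrm_sqr /rdot -hB -/(rdot _ _).
apply: le_trans (rdot_CS _ _) _.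
by rewrite mulrA ler_wpM2r ?nrm_ge0// mulrC bA.
Qed.

End Riesz.

Section BoundedOperators.
Variables (R : realType) (H : hilbertType R).
Implicit Types (A B : H -> H).
Notation adj := (is_adjoint (@dot R H) (@dot R H)).

Lemma bounded_id : bounded_op (@id H).
Proof.
by apply/bounded_opP; split=> //; exists 1 => // x; rewrite mul1r.
Qed.

Lemma bounded_lin (a : R[i]) A B :
  bounded_op A -> bounded_op B -> bounded_op (a *: A + B).
Proof.
move=> /bounded_opP[lA [c c0 bA]] /bounded_opP[lB [d d0 bB]]; apply/bounded_opP; split.
  move=> b x y; rewrite !fctE lA lB !scalerDr !scalerA (mulrC a).
  by rewrite addrACA.
exists (absc a * c + d); first by rewrite ltr_wpDl// mulr_ge0 ?absc_ge0 ?ltW.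
move=> x; apply: le_trans (nrmD _ _) _; rewrite nrmZ mulrDl lerD//.
by rewrite -mulrA ler_wpM2l ?absc_ge0.
Qed.

Lemma bounded_comp A B : bounded_op A -> bounded_op B -> bounded_op (A \o B).
Proof.
move=> /bounded_opP[lA [c c0 bA]] /bounded_opP[lB [d d0 bB]]; apply/bounded_opP; split.
  by move=> b x y /=; rewrite lB lA.
exists (c * d); first by rewrite mulr_gt0.
by move=> x /=; apply: le_trans (bA _) _; rewrite -mulrA ler_wpM2l ?bB// ltW.
Qed.

Lemma bounded0 : bounded_op (0 : H -> H).
Proof.
have <- : (-1) *: (@id H) + @id H = 0.
  by apply/funext => x; rewrite !fctE scaleN1r addNr.
by apply: bounded_lin; exact: bounded_id.
Qed.

Lemma bounded_scale (a : R[i]) A : bounded_op A -> bounded_op (a *: A).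
Proof.
by move=> bA; rewrite -[a *: A]addr0; apply: bounded_lin => //; exact: bounded0.
Qed.

Lemma bounded_sum (I : Type) (s : seq I) (F : I -> H -> H) :
  (forall i, bounded_op (F i)) -> bounded_op (\sum_(i <- s) F i).
Proof.
move=> bF; elim/big_ind: _ => //; first exact: bounded0.
by move=> A B bA bB; rewrite -[A]scale1r; exact: bounded_lin.
Qed.

Lemma adj_sym A B : adj A B -> adj B A.
Proof. by move=> h x y; rewrite dotC -h -dotC. Qed.

Lemma adj_uniq A B C : adj A B -> adj A C -> B = C.
Proof. by move=> hB hC; apply/funext => y; apply: dot_inj => x; rewrite -hB -hC. Qed.

Lemma adj_id : adj id id. Proof. by []. Qed.

Lemma adj_lin (a : R[i]) A A' B B' :
  adj A A' -> adj B B' -> adj (a *: A + B) (a^* *: A' + B').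
Proof.
move=> hA hB x y; rewrite !fctE dotDl dotDr dotZl dotZr hA hB.
by rewrite conjCK.
Qed.

Lemma adj_comp A A' B B' : adj A A' -> adj B B' -> adj (A \o B) (B' \o A').
Proof. by move=> hA hB x y /=; rewrite hA hB. Qed.

Lemma opbound_adj A B c : 0 <= c -> adj A B -> opbound c A -> opbound c B.
Proof.
move=> c0 hB bA y; have [->|By0] := eqVneq (B y) 0.
  by rewrite nrm0 mulr_ge0 ?nrm_ge0.
have Bp : 0 < nrm (B y) by rewrite nrm_gt0.
rewrite -(ler_pM2l Bp) -expr2 nrm_sqr /rdot -hB -/(rdot _ _).
apply: le_trans (rdot_CS _ _) _.
by rewrite mulrA ler_wpM2r ?nrm_ge0// mulrC bA.
Qed.

End BoundedOperators.

(** * Fuglede's theorem *)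

Section RootsOfUnity.
Variable R : realType.

Lemma prim_root_exists n : (0 < n)%N -> exists w : R[i], n.-primitive_root w.
Proof.
move=> n0; pose p : {poly R[i]} := 'X^n - 1.
have [r Dp] := closed_field_poly_normal p.
have mp : lead_coef p = 1 by rewrite lead_coefXnsubC.
rewrite mp scale1r in Dp.
have rn1 : all n.-unity_root r.
  by apply/allP => z; rewrite -root_prod_XsubC -Dp.
have sz_r : (n < (size r).+1)%N.
  by rewrite -(size_prod_XsubC r id) -Dp size_XnsubC.
have [|z] := hasP (has_prim_root n0 rn1 _ sz_r); last by exists z.
by rewrite -separable_prod_XsubC -Dp separable_Xn_sub_1// pnatr_eq0 -lt0n.
Qed.

Lemma absc_prim_root n (w : R[i]) : n.-primitive_root w -> absc w = 1.
Proof.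
move=> pw; have n0 := prim_order_gt0 pw; apply: (@complexI R).
rewrite -normcEabs; apply/eqP; rewrite -(@pexpr_eq1 _ _ n)// -normrX.
by rewrite (prim_expr_order pw) normr1.
Qed.

Lemma sum_prim_root n (w : R[i]) e : n.-primitive_root w ->
  \sum_(k < n) w ^+ (k * e) = if (n %| e)%N then n%:R else 0.
Proof.
move=> pw; case: ifP => [|] ne.
  rewrite (eq_bigr (fun=> 1)) ?sumr_const ?card_ord// => k _.
  by apply/eqP; rewrite -(prim_order_dvd pw) dvdn_mull.
have : (w ^+ e - 1) * \sum_(k < n) w ^+ (k * e) = 0.
  under eq_bigr do rewrite mulnC exprM.
  by rewrite -subrX1 -exprM mulnC exprM (prim_expr_order pw) expr1n subrr.
move/eqP; rewrite mulf_eq0 subr_eq0 -(prim_order_dvd pw) ne /=.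
by move/eqP.
Qed.

(** A discrete Cauchy formula: averaging a polynomial over [n + 1] equally spaced points of a
    circle, with weights [w ^+ (k * n)] inverse to [w ^+ k], isolates the coefficient of degree
    one. *)
Lemma root_filter (V : lmodType R[i]) n (w : R[i]) (r : R[i]) (c : nat -> V) :
  (0 < n)%N -> n.+1.-primitive_root w ->
  \sum_(k < n.+1) w ^+ (k * n) *: \sum_(j < n.+1) (r * w ^+ k) ^+ j *: c j =
  (n.+1%:R * r) *: c 1%N.
Proof.
move=> n0 pw; under eq_bigr do rewrite scaler_sumr.
rewrite exchange_big /=.
rewrite (eq_bigr (fun j : 'I_n.+1 =>
    (r ^+ j * \sum_(k < n.+1) w ^+ (k * (n + j))) *: c j)); last first.
  move=> j _; rewrite mulr_sumr scaler_suml; apply: eq_bigr => k _.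
  by rewrite scalerA exprMn -exprM mulnDr exprD; congr (_ *: _); ring.
have o1 : (1 < n.+1)%N by rewrite ltnS.
rewrite (bigD1 (Ordinal o1)) //= [X in _ + X]big1 ?addr0 => [|j j1].
  by rewrite (sum_prim_root _ pw) addn1 dvdnn expr1 mulrC.
rewrite sum_prim_root// ifF ?mulr0 ?scale0r//.
(* As [0 < n] and [j <= n], the equation [n + j = q (n + 1)] leaves only [q = 1], [j = 1]. *)
apply/negP => /dvdnP[q]; case: q => [|[|q]].
- by move=> /eqP; rewrite mul0n addn_eq0 => /andP[/eqP n00]; rewrite n00 in n0.
- by rewrite mul1n => h; move/eqP: j1; apply; apply: val_inj => /=; lia.
- by have := ltn_ord j; rewrite !mulSn; lia.
Qed.

(** Binomial expansion of [(1 + z D)^n X]; the coefficient [n D X] of degree one is the one that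
    [root_filter] will extract. *)
Lemma iter_affine_expand (V : lmodType R[i]) (D : V -> V) (X : V) n :
  (forall (a : R[i]) Y Z, D (a *: Y + Z) = a *: D Y + D Z) ->
  exists c : nat -> V, [/\ c 0%N = X, c 1%N = D X *+ n,
    forall j, (n < j)%N -> c j = 0 &
    forall z : R[i], iter n (fun Y => Y + z *: D Y) X = \sum_(j < n.+1) z ^+ j *: c j].
Proof.
move=> lD; have D0 : D 0 = 0.
  by have := lD (-1) 0 0; rewrite scaler0 addr0 scaleN1r addNr.
have DZ (a : R[i]) Y : D (a *: Y) = a *: D Y by rewrite -[a *: Y]addr0 lD D0 addr0.
have DD : {morph D : Y Z / Y + Z} by move=> Y Z; rewrite -{1}[Y]scale1r lD scale1r.
elim: n => [|n [c [c0 c1 cj cE]]].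
  exists (fun j => if j is 0%N then X else 0); split=> //; first by case.
  by move=> z; rewrite big_ord_recl big_ord0 expr0 scale1r addr0.
exists (fun j => c j + if j is j'.+1 then D (c j') else 0); split.
- by rewrite c0 addr0.
- by rewrite c1 c0 mulrS addrC.
- by case=> // j nj; rewrite !cj ?D0 ?addr0// ltnW.
move=> z; rewrite iterS cE (big_morph D DD D0) scaler_sumr.
under [in RHS]eq_bigr do rewrite scalerDr; rewrite big_split /=; congr (_ + _).
  by rewrite [RHS]big_ord_recr /= cj// scaler0 addr0.
rewrite [RHS]big_ord_recl /= scaler0 add0r; apply: eq_bigr => j _.
by rewrite DZ scalerA -exprS.
Qed.

End RootsOfUnity.

Section LinearOperators.
Variables (R : realType) (H : hilbertType R).
Implicit Types A B : H -> H.

Lemma lin_zero : linear (0 : H -> H).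
Proof. by move=> a x y; rewrite -[RHS]/(a *: 0 + 0) scaler0 addr0. Qed.

Lemma lin_comb (a : R[i]) A B : linear A -> linear B -> linear (a *: A + B).
Proof.
move=> lA lB b x y; rewrite !fctE lA lB !scalerDr !scalerA (mulrC a).
by rewrite addrACA.
Qed.

Lemma lin_comp A B : linear A -> linear B -> linear (A \o B).
Proof. by move=> lA lB b x y /=; rewrite lB lA. Qed.

End LinearOperators.

Section Fuglede.
Variables (R : realType) (H : hilbertType R).
Variables (N M : H -> H) (C : R).
Hypotheses (lN : linear N) (lM : linear M).
Hypotheses (bN : opbound C N) (bM : opbound C M).
Hypothesis NMadj : is_adjoint (@dot R H) (@dot R H) N M.
Hypothesis NM : forall x, N (M x) = M (N x).
Implicit Types (X : H -> H) (x y : H) (z : R[i]).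

(** The derivation [[M, X]]. The classical proof of Fuglede's theorem applies Liouville's theorem to
    [exp(zM) X exp(-zM)]; here the polynomial [(1 + z adop)^n X] takes the place of this entire
    function. *)
Definition adop X : H -> H := fun x => M (X x) - X (M x).

Definition commutant b X :=
  [/\ linear X, forall x, N (X x) = X (N x) & opbound b X].

Definition skew z x := z *: M x - z^* *: N x.

Lemma rdot_skew z x : rdot x (skew z x) = 0.
Proof.
rewrite rdotBr /rdot !dotZr conjCK.
have -> : dot x (N x) = (dot x (M x))^* by rewrite -NMadj -dotC.
set d := dot x (M x); rewrite !Re_mul !ReJ !ImJ; ring.
Qed.

Lemma nrm_skew z x : nrm (skew z x) <= 2 * absc z * C * nrm x.
Proof.
apply: le_trans (nrmD _ _) _; rewrite nrmN !nrmZ.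
have -> : absc z^* = absc z by rewrite /absc ReJ ImJ sqrrN.
have := ler_wpM2l (absc_ge0 z) (bN x); have := ler_wpM2l (absc_ge0 z) (bM x).
lra.
Qed.

(** Since [skew z x] is orthogonal to [x] for the real inner product, Pythagoras leaves no term of
    first order in [|z|]. *)
Lemma nrm_skew1 (s : bool) z x : 0 <= C ->
  nrm (x + (-1) ^+ s *: skew z x) <=
  Num.sqrt (1 + 4 * absc z ^+ 2 * C ^+ 2) * nrm x.
Proof.
move=> C0; rewrite -(@ler_pXn2r _ 2)// ?nnegrE ?mulr_ge0 ?nrm_ge0 ?sqrtr_ge0//.
rewrite exprMn [X in _ <= X * _]sqr_sqrtr; last first.
  by have := sqr_ge0 (2 * absc z * C); lra.
have -> : nrm (x + (-1) ^+ s *: skew z x) ^+ 2 = nrm x ^+ 2 + nrm (skew z x) ^+ 2.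
  have := rdot_skew z x; move: (skew z x) => y xy; rewrite !nrm_sqr.
  by case: s; rewrite ?expr1 ?expr0 ?scaleN1r ?scale1r !rdotE (rdotC y x) xy; ring.
have : nrm (skew z x) ^+ 2 <= (2 * absc z * C * nrm x) ^+ 2.
  by rewrite ler_pXn2r// ?nnegrE ?nrm_ge0 ?nrm_skew// !mulr_ge0 ?nrm_ge0 ?absc_ge0.
lra.
Qed.

Lemma lin_skew z : linear (skew z).
Proof.
have -> : skew z = (- z^*) *: N + z *: M.
  by apply/funext => x; rewrite !fctE scaleNr addrC.
by apply: lin_comb => //; rewrite -[z *: M]addr0; apply: lin_comb => //; exact: lin_zero.
Qed.

(* [X + z [M, X] = (1 + W) X (1 - W) + W X W] for the skew-adjoint
   [W = z M - conj z N], because [X] commutes with [N]. *)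
Lemma commutant_step b X z : 0 <= C -> 0 <= b -> commutant b X ->
  commutant (b * (1 + 8 * C ^+ 2 * absc z ^+ 2)) (X + z *: adop X).
Proof.
move=> C0 b0 [lX cX bX]; split.
- rewrite addrC; apply: lin_comb => //.
  have -> : adop X = (-1) *: (X \o M) + (M \o X).
    by apply/funext => x; rewrite !fctE /adop /= scaleN1r [RHS]addrC.
  by apply: lin_comb; exact: lin_comp.
- move=> x; rewrite !fctE /adop (linD lN) (linZ lN) (linB lN) ?NM !cX ?NM.
  by rewrite ?NM ?cX.
move=> x; pose s : R := Num.sqrt (1 + 4 * absc z ^+ 2 * C ^+ 2).
have lW : linear (skew z) by apply: lin_skew.
have -> : (X + z *: adop X) x =
    (X (x + (-1) ^+ true *: skew z x) +
     (-1) ^+ false *: skew z (X (x + (-1) ^+ true *: skew z x))) + skew z (X (skew z x)).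
  rewrite expr0 expr1 scale1r scaleN1r (linB lX) (linB lW) -!addrA addNr addr0.
  rewrite !fctE; congr (_ + _); rewrite /adop /skew (linB lX) !(linZ lX) !cX.
  by rewrite scalerBr opprB addrC addrA subrK.
have s0 : 0 <= s := sqrtr_ge0 _.
have s2 : s ^+ 2 = 1 + 4 * absc z ^+ 2 * C ^+ 2.
  by rewrite sqr_sqrtr//; have := sqr_ge0 (2 * absc z * C); lra.
have a0 : 0 <= absc z := absc_ge0 z.
have t1 : nrm (X (x + (-1) ^+ true *: skew z x)) <= b * (s * nrm x).
  by apply: le_trans (bX _) _; rewrite ler_wpM2l// nrm_skew1.
have t2 : nrm (skew z (X (skew z x))) <= 2 * absc z * C * (b * (2 * absc z * C * nrm x)).
  apply: le_trans (nrm_skew _ _) _; rewrite ler_wpM2l ?mulr_ge0//.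
  by apply: le_trans (bX _) _; rewrite ler_wpM2l// nrm_skew.
apply: le_trans (nrmD _ _) _; apply: le_trans (lerD (nrm_skew1 _ _ _ C0) t2) _.
rewrite -/s; have := ler_wpM2l s0 t1.
have -> : s * (b * (s * nrm x)) = s ^+ 2 * b * nrm x by ring.
rewrite s2; lra.
Qed.

Lemma commutant_iter b X z n : 0 <= C -> 0 <= b -> commutant b X ->
  commutant (b * (1 + 8 * C ^+ 2 * absc z ^+ 2) ^+ n)
    (iter n (fun Y => Y + z *: adop Y) X).
Proof.
move=> C0 b0 cX; have g0 : 0 <= 1 + 8 * C ^+ 2 * absc z ^+ 2.
  by have := sqr_ge0 (C * absc z); nra.
elim: n => [|n IHn]; first by rewrite mulr1.
by rewrite iterS exprSr mulrA; apply: commutant_step => //; rewrite mulr_ge0// exprn_ge0.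
Qed.

(** A Cauchy estimate for the degree-one coefficient of [(1 + z adop)^n X] on the circle of radius
    [r]. With [n = (k + 1)^2] and [r = 1 / (k + 1)], the growth factor [(1 + 8 C^2 r^2)^n] is at
    most [exp(8 C^2)] because [n r^2 = 1], while the coefficient carries the factor
    [n r = k + 1]. *)
Lemma adop_bound b X k x : 0 <= C -> 0 <= b -> commutant b X ->
  k.+1%:R * nrm (adop X x) <= b * expR (8 * C ^+ 2) * nrm x.
Proof.
move=> C0 b0 cX; pose n := (k.+1 * k.+1)%N; have n0 : (0 < n)%N by [].
have lD (a : R[i]) Y Z : adop (a *: Y + Z) = a *: adop Y + adop Z.
  apply/funext => y; rewrite !fctE /adop (linD lM) (linZ lM).
  by rewrite scalerBr opprD addrACA.
have [c [_ c1 _ cE]] := iter_affine_expand X n lD.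
have [w pw] := @prim_root_exists R n.+1 isT.
pose r : R := k.+1%:R^-1; have r0 : 0 < r by rewrite invr_gt0 ltr0n.
have := root_filter r%:C c n0 pw.
under eq_bigr do rewrite -cE.
have -> : c 1%N = (n%:R : R[i]) *: adop X by rewrite c1 scaler_nat.
rewrite scalerA fct_sumE.
move=> /(congr1 (fun f : H -> H => nrm (f x))) E.
have lhs : nrm (\sum_(j < n.+1) (w ^+ (j * n) *:
    iter n (fun Y => Y + (r%:C * w ^+ j) *: adop Y) X) x) <=
    n.+1%:R * (b * expR (8 * C ^+ 2) * nrm x).
  apply: le_trans (_ : \sum_(j < n.+1) (b * expR (8 * C ^+ 2) * nrm x) <= _); last first.
    by rewrite sumr_const card_ord [leRHS]mulr_natl.
  apply: (big_ind2 (fun (u : H) (v : R) => nrm u <= v)) => [|u u' v v' hu hv|j _].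
  - by rewrite nrm0.
  - by apply: le_trans (nrmD _ _) _; exact: lerD.
  have aw m : absc (w ^+ m) = 1.
    apply: (@complexI R); rewrite -normcEabs normrX normcEabs.
    by rewrite (absc_prim_root pw) -rmorphXn/= expr1n.
  rewrite fctE nrmZ aw mul1r.
  have [_ _ bI] := commutant_iter (r%:C * w ^+ j) n C0 b0 cX.
  apply: le_trans (bI x) _; rewrite ler_wpM2r ?nrm_ge0// ler_wpM2l//.
  have -> : absc (r%:C * w ^+ j) = r.
    apply: (@complexI R); rewrite -normcEabs normrM !normcEabs aw mulr1.
    by rewrite absc_real ger0_norm ?ltW.
  have -> : expR (8 * C ^+ 2) = expR (8 * C ^+ 2 * r ^+ 2) ^+ n.
    rewrite -expRM_natl; congr expR.
    by rewrite /r natrM; field; rewrite ?nat1r pnatr_eq0.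
  rewrite lerXn2r ?nnegrE ?expR_ge0 ?expR_ge1Dx//.
    by have := sqr_ge0 (C * r); nra.
move: lhs; rewrite [X in X <= _]E -[X in nrm X]/(_ *: adop X x) nrmZ.
have -> : absc (n.+1%:R * r%:C * n%:R) = n.+1%:R * k.+1%:R.
  rewrite -!(rmorph_nat (real_complex R)) -!rmorphM absc_real ger0_norm.
    by rewrite /r natrM; field; rewrite ?nat1r pnatr_eq0.
  by rewrite !mulr_ge0 ?ltW ?ltr0n.
by rewrite -mulrA ler_pM2l ?ltr0n.
Qed.

(** The right-hand side of [adop_bound] does not depend on [k], so [[M, B] x] must vanish. *)
Lemma Fuglede B : 0 <= C -> bounded_op B -> (forall x, N (B x) = B (N x)) ->
  forall x, M (B x) = B (M x).
Proof.
move=> C0 /bounded_opP[lB [b b0 bB]] cB x.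
apply/eqP; rewrite -subr_eq0 -nrm_eq0 eq_le nrm_ge0 andbT.
have cX : commutant b B by [].
rewrite leNgt; apply/negP => d0.
pose K := b * expR (8 * C ^+ 2) * nrm x.
have := truncnS_gt (K / nrm (adop B x)); rewrite ltNge => /negP; apply.
by rewrite ler_pdivlMr//; exact: adop_bound (ltW b0) cX.
Qed.

End Fuglede.

(** * The scalars as a Hilbert space *)

(* A copy of R[i]^o: the canonical complete structure of [_^o] is already taken by
   the reals. *)
Definition complex_line (R : realType) : Type := R[i]^o.
HB.instance Definition _ (R : realType) := NormedModule.copy (complex_line R) R[i]^o.

Section ComplexHilbert.
Variable R : realType.

Lemma normcEabs_regular (a : (complex_line R)) : `|a| = (absc a)%:C.
Proof. exact: normcEabs. Qed.

Lemma complex_complete (F : set_system (complex_line R)) : ProperFilter F -> cauchy F -> cvg F.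
Proof.
move=> FF /cauchyP cF.
have part (p : R[i] -> R) : (forall a b, `|p a - p b| <= absc (a - b)) ->
    exists l, forall e, 0 < e -> \forall x \near F, `|l - p x| < e.
  move=> pb; have : cvg (p @ F).
    apply/cauchy_cvgP/cauchy_exP => e e0.
    have [|x Fx] := cF e%:C; first by rewrite ltcR.
    exists (p x); suff : F [set y | ball (p x) e (p y)] by [].
    apply: filterS Fx => y /=.
    rewrite -!ball_normE => xy; have : (absc (x - y))%:C < e%:C.
      by rewrite -normcEabs; exact: xy.
    by rewrite ltcR; exact: le_lt_trans (pb _ _).
  by move=> /cvg_ex[l /cvgrPdist_lt h]; exists l.
have [|a ha] := part (@complex.Re R).
  by move=> a b; rewrite -ReB Re_le_absc.
have [|b hb] := part (@complex.Im R).
  by move=> x y; rewrite -ImB Im_le_absc.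
apply/cvg_ex; exists (Complex a b : (complex_line R)).
apply/cvgrPdist_lt => e /gt0_complexE[-> e0].
have e2 : 0 < Re e / 2 by rewrite divr_gt0.
near=> x; suff: (absc (Complex a b - x))%:C < (Re e)%:C by rewrite -normcEabs.
rewrite ltcR -(@ltr_pXn2r _ 2)// ?nnegrE ?absc_ge0 ?ltW//.
rewrite absc_sqr ReB ImB /=.
have : `|a - Re x| < Re e / 2 by near: x; exact: ha.
have : `|b - Im x| < Re e / 2 by near: x; exact: hb.
rewrite !ltr_norml => /andP[? ?] /andP[? ?]; nra.
Unshelve. all: by end_near. Qed.

Definition complex_dot (x y : (complex_line R)) : R[i] := x * y^*.

Lemma complex_dot_bilinear :
  bilinear_for (GRing.Scale.Law.clone _ _ *%R _)
    (GRing.Scale.Law.clone _ _ (Num.conj \; *%R) _) complex_dot.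
Proof.
split=> [y a x z|x a y z] /=; rewrite /complex_dot; first by rewrite mulrDl mulrA.
by rewrite rmorphD rmorphM mulrDr mulrCA.
Qed.

HB.instance Definition _ :=
  bilinear_isBilinear.Build R[i] (complex_line R) (complex_line R) R[i] _ _ complex_dot complex_dot_bilinear.

Lemma complex_dot_herm (x y : (complex_line R)) :
  complex_dot x y = (-1) ^+ false * Num.conj (complex_dot y x).
Proof.
have h (a b : R[i]) : a * b^* = (b * a^*)^* by rewrite rmorphM /= conjCK mulrC.
by rewrite expr0 mul1r; exact: h.
Qed.

HB.instance Definition _ :=
  isHermitianSesquilinear.Build R[i] (complex_line R) false Num.conj complex_dot complex_dot_herm.

Lemma complex_dot_gt0 (x : (complex_line R)) : x != 0 -> 0 < complex_dot x x.
Proof. by move=> x0; rewrite /complex_dot mul_conjC_gt0. Qed.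

HB.instance Definition _ := isDotProduct.Build R[i] (complex_line R) complex_dot complex_dot_gt0.

HB.instance Definition _ := Uniform_isComplete.Build (complex_line R) complex_complete.

Lemma complex_dot_normE (x : (complex_line R)) : complex_dot x x = `|x| ^+ 2.
Proof. by rewrite /complex_dot -normCK. Qed.

HB.instance Definition _ :=
  CompleteNormedModule_isHilbert.Build R (complex_line R) complex_dot_normE.

End ComplexHilbert.


(** [nrm_cauchy] in the one-dimensional Hilbert space [complex_line R]. *)
Lemma absc_cauchy (R : realType) (u : nat -> R[i]) :
  (forall e, 0 < e -> exists N, forall n k, (N <= n)%N -> (N <= k)%N -> absc (u n - u k) < e) ->
  exists l, forall e, 0 < e -> exists N, forall n, (N <= n)%N -> absc (l - u n) < e.
Proof.
have nE (a : (complex_line R)) : nrm a = absc a.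
  by apply: (@complexI R); rewrite -normE normcEabs_regular.
move=> cu; have [e e0|l hl] := @nrm_cauchy R (complex_line R) u.
  by have [N hN] := cu e e0; exists N => n k Nn Nk; rewrite nE; exact: hN.
by exists l => e /hl[N hN]; exists N => n Nn; rewrite -nE; exact: hN.
Qed.

(** * Joint approximate eigenvalues *)

Section JointApproximation.
Variables (R : realType) (H : hilbertType R).
Implicit Types (A B : H -> H) (l : seq (H -> H)) (al : (H -> H) -> R) (x y : H).

Definition selfadj A := bounded_op A /\ is_adjoint (@dot R H) (@dot R H) A A.

Definition approx_eigen l al e x :=
  nrm x = 1 /\ forall A, A \in l -> nrm (A x - (al A)%:C *: x) <= e.

Lemma selfadj_rdot A x y : selfadj A -> rdot (A x) y = rdot x (A y).
Proof. by move=> [_ h]; rewrite /rdot h. Qed.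

(* A near-maximizer [x] of [<A x, x>] over the approximate eigenvectors of [l] is
   an approximate eigenvector of [A]: since [A] commutes with [l], a small step from
   [x] along [(A - a) x] stays among them and would otherwise increase the value. *)
Lemma approx_eigen_step l al A :
  (forall B, B \in l -> bounded_op B) -> selfadj A ->
  (forall B x, B \in l -> A (B x) = B (A x)) ->
  (forall e, 0 < e -> exists x, approx_eigen l al e x) ->
  exists a, (forall e, 0 < e ->
      exists x, approx_eigen l al e x /\ nrm (A x - a%:C *: x) <= e) /\
    (forall c, (forall e, 0 < e -> exists x, approx_eigen l al e x /\ c <= rdot (A x) x) ->
      c <= a).
Proof.
move=> bl sA cA hl; have [/bounded_opP[lA [C C0 bA]] _] := sA.
have Ax x : nrm x = 1 -> `|rdot (A x) x| <= C.
  move=> x1; apply: le_trans (Re_le_absc _) _; apply: le_trans (dot_CS _ _) _.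
  by rewrite x1 mulr1; have := bA x; rewrite x1 mulr1.
pose V e := [set rdot (A x) x | x in approx_eigen l al e].
have supV e : 0 < e -> has_sup (V e).
  move=> /hl[x hx]; split; first by exists (rdot (A x) x), x.
  by exists C => _ [y [y1 _] <-]; apply: le_trans (Ax _ y1); exact: ler_norm.
(* [sup (V e)] decreases with [e], so the infimum [a] of [S] is its limit as [e] tends to 0. *)
pose S := [set sup (V e) | e in [set e | 0 < e]].
have infS : has_inf S.
  split; first by exists (sup (V 1)), 1 => //=.
  exists (- C) => _ [e /= e0 <-]; have [x hx] := hl e e0.
  apply: le_trans (_ : rdot (A x) x <= _).
    by have := Ax x hx.1; rewrite ler_norml => /andP[].
  by apply: (sup_upper_bound (supV e e0)); exists x.
pose a := inf S.
have aS e : 0 < e -> a <= sup (V e).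
  by move=> e0; apply: ge_inf; [exact: infS.2|exists e].
exists a; split; last first.
  move=> c hc; apply: lb_le_inf; first exact: infS.1.
  move=> _ [e /= e0 <-]; have [x [hx cx]] := hc e e0.
  by apply: le_trans cx _; apply: (sup_upper_bound (supV e e0)); exists x.
move=> e e0; pose D := C + `|a|.
have D0 : 0 < D by rewrite ltr_wpDr.
pose Q x := A x - a%:C *: x.
have bQ x : nrm (Q x) <= D * nrm x.
  apply: le_trans (nrmD _ _) _; rewrite nrmN nrmZ absc_real mulrDl lerD//.
have lQ : linear Q.
  by move=> b x y; rewrite /Q lA !scalerDr !scalerN !scalerA opprD addrACA (mulrC b).
have K0 : 0 < 5 + D ^+ 3 by rewrite ltr_wpDr// exprn_ge0 ?ltW.
(* The first bound keeps the norm of [y = x + t Q x] between 1/2 and 2. In the second, [5 = 4 + 1]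
   collects the errors in [Qy] and [Qx], and [D ^+ 3] bounds the second-order term of [<Q y, y>]. *)
pose t := Num.min (2 * D)^-1 (e ^+ 2 / (5 + D ^+ 3)).
have t0 : 0 < t by rewrite lt_min invr_gt0 mulr_gt0// divr_gt0// exprn_gt0.
have tD : t * D <= 2^-1.
  have : t <= (2 * D)^-1 by rewrite ge_min lexx.
  move/(ler_wpM2r (ltW D0)); suff -> : (2 * D)^-1 * D = 2^-1 by [].
  by field; rewrite gt_eqF.
have te : t * (5 + D ^+ 3) <= e ^+ 2.
  by rewrite -ler_pdivlMr// ge_min lexx orbT.
have t20 : 0 < t ^+ 2 by rewrite exprn_gt0.
(* [e1] is so small that no [e1]-approximate eigenvector exceeds [a + t^2]. Starting from [e1 / 3]
   leaves room for the step: the defect grows by at most 3/2, and normalizing [y] at most doubles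
   it. *)
have [_ [e1 /= e10 <-] he1] := inf_adherent t20 infS.
pose e2 := Num.min e (e1 / 3).
have e20 : 0 < e2 by rewrite lt_min e0 divr_gt0.
have [_ [x hx <-] xa] := sup_adherent t20 (supV e2 e20).
have {}xa : a - t ^+ 2 <= rdot (A x) x.
  by apply: le_trans (ltW xa); rewrite lerD2r aS.
exists x; have [x1 xl] := hx.
split; first by split=> // B /xl/le_trans; apply; rewrite ge_min lexx.
rewrite -/(Q x); pose y := x + t%:C *: Q x.
have tQ : nrm (t%:C *: Q x) <= 2^-1.
  rewrite nrmZ absc_real gtr0_norm//; apply: le_trans tD.
  by rewrite ler_pM2l//; have := bQ x; rewrite x1 mulr1.
have y1 : 2^-1 <= nrm y.
  have := nrmD y (- (t%:C *: Q x)); rewrite addrK x1 nrmN; lra.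
have y2 : nrm y <= 2 by apply: le_trans (nrmD _ _) _; rewrite x1; lra.
have y0 : y != 0 by rewrite -nrm_gt0; lra.
have yp : 0 < nrm y by rewrite nrm_gt0.
have : rdot (A ((nrm y)^-1%:C *: y)) ((nrm y)^-1%:C *: y) <= sup (V e1).
  apply: (sup_upper_bound (supV e1 e10)); exists ((nrm y)^-1%:C *: y) => //.
  split; first exact: nrm_unit.
  move=> B Bl; have [lB _] := (bounded_opP B).1 (bl B Bl).
  pose b := al B.
  have QB z : Q (B z - b%:C *: z) = B (Q z) - b%:C *: Q z.
    by rewrite (linB lQ) (linZ lQ) /Q (linB lB) (linZ lB) cA.
  have -> : B ((nrm y)^-1%:C *: y) - b%:C *: ((nrm y)^-1%:C *: y) =
      (nrm y)^-1%:C *: ((B x - b%:C *: x) + t%:C *: Q (B x - b%:C *: x)).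
    rewrite QB (linZ lB) scalerA mulrC -scalerA -scalerBr; congr (_ *: _).
    rewrite /y (linD lB) (linZ lB) scalerDr opprD addrACA; congr (_ + _).
    rewrite [RHS]scalerBr; congr (_ - _); move: (Q x) => v.
    by rewrite !scalerA mulrC.
  rewrite nrmZ absc_real gtr0_norm ?invr_gt0// ler_pdivrMl//.
  apply: le_trans (nrmD _ _) _; rewrite nrmZ absc_real gtr0_norm//.
  have h1 := xl B Bl; have h2 := bQ (B x - b%:C *: x).
  have h3 : nrm (B x - b%:C *: x) <= e1 / 3 by apply: le_trans h1 _; rewrite ge_min lexx orbT.
  have h4 : t * nrm (Q (B x - b%:C *: x)) <= 2^-1 * nrm (B x - b%:C *: x).
    apply: le_trans (_ : t * (D * nrm (B x - b%:C *: x)) <= _); first by rewrite ler_pM2l.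
    by rewrite mulrA ler_wpM2r ?nrm_ge0.
  have h5 := ler_wpM2r (ltW e10) y1; lra.
move=> /le_lt_trans /(_ he1); rewrite (linZ lA) rdotZl rdotZr => h.
have {h} ya : rdot (A y) y <= (a + t ^+ 2) * nrm y ^+ 2.
  rewrite -/a in h; move: h; set r := rdot _ _; rewrite mulrA -invfM -expr2 => h.
  by rewrite -ler_pdivrMr ?exprn_gt0// mulrC ltW.
have Qy : rdot (Q y) y <= 4 * t ^+ 2.
  rewrite /Q rdotBl rdotZl -nrm_sqr; have : nrm y ^+ 2 <= 4 by nra.
  by move=> h; have := ler_wpM2l (ltW t20) h; lra.
have Qx : - t ^+ 2 <= rdot (Q x) x.
  by rewrite /Q rdotBl rdotZl -nrm_sqr x1; lra.
have QQ : - D ^+ 3 <= rdot (Q (Q x)) (Q x).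
  have : `|rdot (Q (Q x)) (Q x)| <= nrm (Q (Q x)) * nrm (Q x).
    by apply: le_trans (Re_le_absc _) _; exact: dot_CS.
  rewrite ler_norml => /andP[+ _]; apply: le_trans; rewrite lerN2.
  have q1 := bQ x; rewrite x1 mulr1 in q1; have q2 := bQ (Q x).
  have q0 := nrm_ge0 (Q x).
  apply: le_trans (ler_wpM2r q0 q2) _; rewrite -mulrA !exprS expr0 mulr1.
  by rewrite ler_pM2l// ler_pM.
have symQ : rdot (Q (Q x)) x = rdot (Q x) (Q x).
  by rewrite {1 4}/Q rdotBl rdotBr rdotZl rdotZr selfadj_rdot.
have : rdot (Q y) y = rdot (Q x) x + 2 * t * nrm (Q x) ^+ 2 + t ^+ 2 * rdot (Q (Q x)) (Q x).
  rewrite /y (linD lQ) (linZ lQ) nrm_sqr.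
  move: symQ; move: (Q (Q x)) => w; move: (Q x) => v wx.
  by rewrite !rdotE wx; ring.
move=> yE; rewrite yE in Qy; have := ler_wpM2l (ltW t20) QQ => QQ2.
rewrite -(@ler_pXn2r _ 2)// ?nnegrE ?nrm_ge0 ?(ltW e0)//; apply: (le_trans _ te).
rewrite -(ler_pM2l t0); set q := nrm _ ^+ 2 in Qy *.
have q0 : 0 <= q by exact: sqr_ge0.
have := mulr_ge0 (ltW t0) q0; rewrite expr2 in Qy Qx QQ2 *; lra.
Qed.

(** [A0] is treated first, when every unit vector still competes, so that its value is at least
    [<A0 x0, x0>]; the operators of [l] are then added one at a time. *)
Lemma joint_approx_eigen l A0 (x0 : H) : selfadj A0 ->
  (forall A, A \in l -> selfadj A) ->
  (forall A x, A \in l -> A0 (A x) = A (A0 x)) ->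
  (forall A B x, A \in l -> B \in l -> A (B x) = B (A x)) ->
  nrm x0 = 1 ->
  exists al, rdot (A0 x0) x0 <= al A0 /\
    forall e, 0 < e -> exists x, approx_eigen (A0 :: l) al e x.
Proof.
move=> s0 + + + x01; elim: l => [_ _ _|A l IHl sl c0 cl].
  have h0 e : 0 < e -> exists x, approx_eigen [::] (fun=> 0) e x by exists x0.
  have [//|//|a [ha ca]] := @approx_eigen_step [::] (fun=> 0) A0 _ s0 _ h0.
  exists (fun=> a); split; first by apply: ca => e e0; exists x0.
  move=> e /ha[x [[x1 _] hx]]; exists x; split=> // B; rewrite inE => /eqP ->.
  exact: hx.
have [|||al [al0 hal]] := IHl.
- by move=> B Bl; apply: sl; rewrite inE Bl orbT.
- by move=> B x Bl; apply: (c0 B); rewrite inE Bl orbT.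
- by move=> B B' x Bl B'l; apply: (cl B B'); rewrite inE ?Bl ?B'l orbT.
have Al : A \in A :: l by rewrite inE eqxx.
(* An operator that already occurs keeps its value; otherwise [al] may be redefined at [A] without
   disturbing the others. *)
have [Ain|Anotin] := boolP (A \in A0 :: l).
  exists al; split=> // e /hal[x [x1 hx]]; exists x; split=> // B.
  rewrite !inE => /or3P[B0|/eqP->|Bl]; apply: hx => //; first by rewrite inE B0.
  by rewrite inE Bl orbT.
have [|||a [ha _]] := @approx_eigen_step (A0 :: l) al A _ _ _ hal.
- by move=> B; rewrite inE => /orP[/eqP->|Bl]; [case: s0|case: (sl B)=> //; rewrite inE Bl orbT].
- exact: sl.
- move=> B x; rewrite inE => /orP[/eqP->|Bl]; first by rewrite (c0 A).
  by apply: (cl A B); rewrite // inE Bl orbT.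
exists (fun B => if B == A then a else al B); split.
  by case: eqP => // E; rewrite E inE eqxx in Anotin.
move=> e /ha[x [[x1 hx] hA]]; exists x; split=> // B.
case: (eqVneq B A) => [->//|BA]; rewrite !inE (negbTE BA) /= => Bin.
by apply: hx; rewrite inE.
Qed.

End JointApproximation.

(** * Characters from approximate eigenvectors *)

Section OperatorAlgebra.
Variables (R : realType) (H : hilbertType R).
Implicit Types (A B : H -> H) (G : set (H -> H)).

(** The purely algebraic span, with neither adjoints nor limits: it carries boundedness and
    commutation from the generators to polynomials in them. *)
Inductive op_alg G : (H -> H) -> Prop :=
| op_alg_gen A : G A -> op_alg G A
| op_alg_id : op_alg G id
| op_alg_lin (a : R[i]) A B : op_alg G A -> op_alg G B -> op_alg G (a *: A + B)
| op_alg_comp A B : op_alg G A -> op_alg G B -> op_alg G (A \o B).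

Lemma op_alg_bounded G A : (forall B, G B -> bounded_op B) -> op_alg G A -> bounded_op A.
Proof.
move=> bG; elim=> [B /bG //||a B B' _ bB _ bB'|B B' _ bB _ bB'].
- exact: bounded_id.
- exact: bounded_lin.
- exact: bounded_comp.
Qed.

Lemma op_alg0 G : op_alg G 0.
Proof.
have <- : (-1) *: (@id H) + @id H = 0 by apply/funext => x; rewrite !fctE scaleN1r addNr.
by apply: op_alg_lin; exact: op_alg_id.
Qed.

Lemma op_alg_scale G (a : R[i]) A : op_alg G A -> op_alg G (a *: A).
Proof. by move=> gA; rewrite -[_ *: _]addr0; apply: op_alg_lin => //; exact: op_alg0. Qed.

Lemma op_alg_sum G (I : Type) (s : seq I) (F : I -> H -> H) :
  (forall i, op_alg G (F i)) -> op_alg G (\sum_(i <- s) F i).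
Proof.
move=> gF; elim/big_ind: _ => //; first exact: op_alg0.
by move=> A B gA gB; rewrite -[A]scale1r; exact: op_alg_lin.
Qed.

Lemma op_alg_comm G : (forall A, G A -> bounded_op A) ->
  (forall A B x, G A -> G B -> A (B x) = B (A x)) ->
  forall A B x, op_alg G A -> op_alg G B -> A (B x) = B (A x).
Proof.
move=> bG cG.
have step A B x : G A -> op_alg G B -> A (B x) = B (A x).
  move=> GA gB; have [lA _] := (bounded_opP A).1 (bG A GA).
  elim: gB x => [B' /(cG _ _ _ GA)//|//|a B1 B2 _ h1 _ h2 x|B1 B2 _ h1 _ h2 x].
    by rewrite !fctE lA h1 h2.
  by rewrite /= h1 h2.
move=> A B x gA gB; have [lB _] := (bounded_opP B).1 (op_alg_bounded bG gB).
elim: gA x => [A' GA' x|//|a B1 B2 _ h1 _ h2 x|B1 B2 _ h1 _ h2 x].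
- exact: (step A' B).
- by rewrite !fctE lB h1 h2.
- by rewrite /= h2 h1.
Qed.

End OperatorAlgebra.

Section ApproximateCharacter.
Variables (R : realType) (H : hilbertType R) (x : nat -> H).
Hypothesis x1 : forall n, nrm (x n) = 1.
Implicit Types (A B : H -> H) (a b : R[i]).
Notation adj := (is_adjoint (@dot R H) (@dot R H)).

(** The sequence [x] consists of approximate eigenvectors of [A] for the eigenvalue [a]. By
    [acts_uniq] this is a partial function of [A], from which the character is made. *)
Definition acts A a := forall e : R, 0 < e ->
  exists N, forall n, (N <= n)%N -> nrm (A (x n) - a *: x n) < e.

Lemma acts_uniq A a b : acts A a -> acts A b -> a = b.
Proof.
move=> ha hb; apply/eqP; rewrite -subr_eq0 -normr_eq0 normcEabs eq_complex /= eqxx andbT.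
rewrite eq_le absc_ge0 andbT leNgt; apply/negP => d0.
have d2 : 0 < absc (a - b) / 2 by rewrite divr_gt0.
have [N1 h1] := ha _ d2; have [N2 h2] := hb _ d2.
have := h1 (maxn N1 N2) (leq_maxl _ _); have := h2 (maxn N1 N2) (leq_maxr _ _).
set y := x _ => h3 h4; have := nrmD (A y - b *: y) (- (A y - a *: y)).
rewrite nrmN opprB addrC subrKA -scalerBl nrmZ x1 mulr1; lra.
Qed.

Lemma acts_id : acts id 1.
Proof. by move=> e e0; exists 0%N => n _; rewrite scale1r subrr nrm0. Qed.

Lemma acts_lin c A B a b : acts A a -> acts B b -> acts (c *: A + B) (c * a + b).
Proof.
move=> hA hB e e0; have d0 : 0 < absc c + 1 by rewrite ltr_wpDl ?absc_ge0.
have [N1 h1] := hA (e / 2 / (absc c + 1)) ltac:(by rewrite !divr_gt0).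
have [N2 h2] := hB (e / 2) ltac:(by rewrite divr_gt0).
exists (maxn N1 N2) => n; rewrite geq_max => /andP[/h1 + /h2]; set y := x n.
rewrite ltr_pdivlMr// => h3 h4.
have -> : (c *: A + B) y - (c * a + b) *: y = c *: (A y - a *: y) + (B y - b *: y).
  by rewrite !fctE scalerBr scalerDl opprD scalerA addrACA.
apply: le_lt_trans (nrmD _ _) _; rewrite nrmZ.
have := nrm_ge0 (A y - a *: y); nra.
Qed.

Lemma acts_comp A B a b : bounded_op A -> acts A a -> acts B b -> acts (A \o B) (a * b).
Proof.
move=> /bounded_opP[lA [C C0 bA]] hA hB e e0.
have d0 : 0 < absc b + 1 by rewrite ltr_wpDl ?absc_ge0.
have [N1 h1] := hA (e / 2 / (absc b + 1)) ltac:(by rewrite !divr_gt0).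
have [N2 h2] := hB (e / 2 / C) ltac:(by rewrite !divr_gt0).
exists (maxn N1 N2) => n; rewrite geq_max => /andP[/h1 + /h2]; set y := x n.
rewrite !ltr_pdivlMr// => h3 h4.
have -> : (A \o B) y - (a * b) *: y = A (B y - b *: y) + b *: (A y - a *: y).
  by rewrite /= (linB lA) (linZ lA) scalerBr scalerA (mulrC a) addrA subrK.
apply: le_lt_trans (nrmD _ _) _; rewrite nrmZ.
have := bA (B y - b *: y); have := nrm_ge0 (A y - a *: y); nra.
Qed.

Lemma acts0 : acts 0 0.
Proof. by move=> e e0; exists 0%N => n _; rewrite scale0r subr0 nrm0. Qed.

Lemma acts_scale c A a : acts A a -> acts (c *: A) (c * a).
Proof.
move=> hA; rewrite -[_ *: _]addr0 -[_ * _]addr0; apply: acts_lin => //; exact: acts0.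
Qed.

Lemma acts_sum (I : Type) (s : seq I) (F : I -> H -> H) (f : I -> R[i]) :
  (forall i, acts (F i) (f i)) -> acts (\sum_(i <- s) F i) (\sum_(i <- s) f i).
Proof.
move=> hF; elim/big_ind2: _ => //; first exact: acts0.
by move=> A a B b hA hB; have := acts_lin 1 hA hB; rewrite scale1r mul1r.
Qed.

(** The condition on the adjoint is built in, so that this set is stable under adjoints. *)
Definition star_acts : set (H -> H) := [set A | bounded_op A /\
  exists B a, [/\ bounded_op B, adj A B, acts A a & acts B a^*]].

Lemma acts_approx A a b : (forall e : R, 0 < e -> exists B c,
    [/\ forall y, nrm (A y - B y) <= e * nrm y, acts B c & absc (a - c) <= e]) ->
  acts A a.
Proof.
move=> h e e0; have e3 : 0 < e / 3 by rewrite divr_gt0.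
have [B [c [hB /(_ _ e3)[N hN] ac]]] := h _ e3.
exists N => n /hN; set y := x n => hn.
have -> : A y - a *: y = (A y - B y) + (B y - c *: y) + (c - a) *: y.
  by rewrite scalerBl !addrA !subrK.
have := hB y; rewrite x1 mulr1 => h1.
apply: le_lt_trans (nrmD _ _) _; rewrite nrmZ x1 mulr1.
have -> : absc (c - a) = absc (a - c).
  by apply: (@complexI R); rewrite -!normcEabs distrC.
by apply: le_lt_trans (lerD (nrmD _ _) (lexx _)) _; lra.
Qed.

(** If [B_k] converges to [A] in norm, testing on a common [x n] shows that the eigenvalues of [B_k]
    form a Cauchy sequence; their limit is the eigenvalue of [A]. Its conjugate serves [A'], since
    taking adjoints preserves operator bounds. *)
Lemma star_acts_closed A : bounded_op A ->
  (forall e : R[i], 0 < e -> exists2 B, star_acts B & forall y, `|A y - B y| <= e * `|y|) ->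
  star_acts A.
Proof.
move=> bA clA; have [A' [bA' AA']] := adjoint_exists bA.
have /choice[f hf] : forall k : nat, exists Bb : ((H -> H) * (H -> H)) * R[i],
   [/\ bounded_op Bb.1.1 , bounded_op Bb.1.2, adj Bb.1.1 Bb.1.2,
     acts Bb.1.1 Bb.2 /\ acts Bb.1.2 Bb.2^*
     & opbound k.+1%:R^-1 (A - Bb.1.1)].
  move=> k; have [|B [bB [B' [b [bB' BB' aB aB']]]] hB] := clA (k.+1%:R^-1)%:C.
    by rewrite ltcR invr_gt0 ltr0n.
  exists (B, B', b); split=> // y; have := hB y.
  by rewrite !normE -rmorphM/= lecR.
have k0 k : 0 <= k.+1%:R^-1 :> R by rewrite invr_ge0 ler0n.
have adjB k : opbound k.+1%:R^-1 (A' - (f k).1.2).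
  have [_ _ ad _] := hf k; apply: opbound_adj => // y z.
  by rewrite !fctE dotBl dotBr AA' ad.
have close k j : absc ((f k).2 - (f j).2) <= k.+1%:R^-1 + j.+1%:R^-1.
  apply/ler_addgt0Pr => e e0; have e2 : 0 < e / 2 by rewrite divr_gt0.
  have [_ _ _ [/(_ _ e2)[N1 h1] _] b1] := hf k.
  have [_ _ _ [/(_ _ e2)[N2 h2] _] b2] := hf j.
  have := h1 (maxn N1 N2) (leq_maxl _ _); have := h2 (maxn N1 N2) (leq_maxr _ _).
  set y := x _ => h3 h4; have := b1 y; have := b2 y; rewrite !fctE x1 !mulr1 => h5 h6.
  have -> : absc ((f k).2 - (f j).2) = nrm (((f k).2 - (f j).2) *: y).
    by rewrite nrmZ x1 mulr1.
  have -> : ((f k).2 - (f j).2) *: y = - ((f k).1.1 y - (f k).2 *: y) +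
     (((f j).1.1 y - (f j).2 *: y) + ((A y - (f j).1.1 y) - (A y - (f k).1.1 y))).
    rewrite scalerBl !opprB [X in _ = _ + (_ + X)]addrC [X in _ = _ + (_ + X)]addrA subrK.
    by rewrite [X in _ = _ + X]addrC [X in _ = _ + X]addrA subrK addrA subrK.
  apply: le_trans (nrmD _ _) _; rewrite nrmN.
  apply: le_trans (lerD (lexx _) (nrmD _ _)) _.
  apply: le_trans (lerD (lexx _) (lerD (lexx _) (nrmD _ _))) _; rewrite nrmN.
  move: h3 h4 h5 h6; move: (k.+1%:R^-1) (j.+1%:R^-1) => u v; lra.
have [e e0|a ha] := @absc_cauchy R (fun k => (f k).2).
  have [N hN] := @invSn_lt R (e / 2) ltac:(by rewrite divr_gt0).
  exists N => n k /hN h1 /hN h2; apply: le_lt_trans (close n k) _.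
  move: h1 h2; move: (n.+1%:R^-1) (k.+1%:R^-1) => u v; lra.
split=> //; exists A', a; split=> //; apply: acts_approx => // e e0;
  have [N1 h1] := invSn_lt e0; have [N2 h2] := ha e e0;
  have := h1 _ (leq_maxl N1 N2); have := h2 _ (leq_maxr N1 N2);
  set k := maxn N1 N2 => h3 h4; have [_ _ _ [a1 a2] b1] := hf k.
- exists (f k).1.1, (f k).2; split=> //; last exact: ltW.
  by move=> y; apply: le_trans (b1 y) _; rewrite ler_wpM2r ?nrm_ge0// ltW.
- exists (f k).1.2, (f k).2^*; split=> //.
    by move=> y; apply: le_trans (adjB k y) _; rewrite ler_wpM2r ?nrm_ge0// ltW.
  rewrite -rmorphB; have -> : absc (a - (f k).2)^* = absc (a - (f k).2).
    by rewrite /absc ReJ ImJ sqrrN.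
  exact: ltW.
Qed.

Lemma star_acts_algebra : unital_cstar_subalgebra star_acts.
Proof.
split.
- by move=> A [].
- split; first exact: bounded_id.
  exists id, 1; split; rewrite ?rmorph1; [exact: bounded_id|exact: adj_id|exact: acts_id|exact: acts_id].
- move=> c A B [bA [A' [a [bA' AA' aA aA']]]] [bB [B' [b [bB' BB' aB aB']]]].
  split; first exact: bounded_lin.
  exists (c^* *: A' + B'), (c * a + b); split; first exact: bounded_lin.
  + exact: adj_lin.
  + exact: acts_lin.
  + by rewrite rmorphD rmorphM; exact: acts_lin.
- move=> A B [bA [A' [a [bA' AA' aA aA']]]] [bB [B' [b [bB' BB' aB aB']]]].
  split; first exact: bounded_comp.
  exists (B' \o A'), (a * b); split; first exact: bounded_comp.
  + exact: adj_comp.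
  + exact: acts_comp.
  + by rewrite rmorphM mulrC; exact: acts_comp.
- split; last exact: star_acts_closed.
  move=> A B [bA [A' [a [bA' AA' aA aA']]]] bB AB; split=> //.
  rewrite (adj_uniq AB AA'); exists A, a^*; split=> //; first exact: adj_sym.
  by rewrite conjCK.
Qed.

(** [star_acts] is a unital C*-algebra containing [T], hence contains [generated_cstar T]; sending
    each operator there to its approximate eigenvalue is a character. *)
Lemma approx_joint_spectrum d (T T' : 'I_d -> H -> H) (la : 'rV[R[i]]_d) :
  (forall i, bounded_op (T i)) -> (forall i, bounded_op (T' i)) ->
  (forall i, adj (T i) (T' i)) -> (forall i, acts (T i) (la 0 i)) ->
  (forall i, acts (T' i) (la 0 i)^*) -> joint_spectrum T la.
Proof.
move=> bT bT' TT' aT aT'.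
have sub : generated_cstar T `<=` star_acts.
  move=> A; apply; split; first exact: star_acts_algebra.
  by move=> _ [i _ <-]; split=> //; exists (T' i), (la 0 i).
(* The default 0 is never taken on [generated_cstar T], where an eigenvalue always exists. *)
pose chi A := xget 0 [set a | acts A a].
have chiE A a : acts A a -> chi A = a.
  move=> aA; apply: (@acts_uniq A) => //; exact: (xgetI (P := [set a | acts A a]) 0 aA).
exists chi => [|i]; last exact: chiE.
split; first by apply: chiE; exact: acts_id.
- move=> c A B /sub[_ [_ [a [_ _ aA _]]]] /sub[_ [_ [b [_ _ aB _]]]].
  by rewrite (chiE _ _ aA) (chiE _ _ aB); apply: chiE; exact: acts_lin.
- move=> A B /sub[bA [_ [a [_ _ aA _]]]] /sub[_ [_ [b [_ _ aB _]]]].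
  by rewrite (chiE _ _ aA) (chiE _ _ aB); apply: chiE; exact: acts_comp.
Qed.

End ApproximateCharacter.

(** * Normal tuples *)

Section NormalTuples.
Variables (R : realType) (d : nat) (L : hilbertType R) (N : 'I_d -> L -> L).
Notation adj := (is_adjoint (@dot R L) (@dot R L)).

Definition star_gen (N' : 'I_d -> L -> L) : set (L -> L) := range N `|` range N'.

(** Normality makes [N' i] commute with [N i] only; Fuglede's theorem extends this to every [N j],
    and taking adjoints handles the pairs [N' i], [N' j]. *)
Lemma normal_tuple_adjoints : normal_tuple N -> exists N' : 'I_d -> L -> L,
  [/\ forall A, star_gen N' A -> bounded_op A,
      forall i, adj (N i) (N' i),
      forall A B x, star_gen N' A -> star_gen N' B -> A (B x) = B (A x)
    & forall i x, nrm (N' i x) = nrm (N i x)].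
Proof.
move=> [nN cN].
have /choice[N' hN'] : forall i, exists B, [/\ bounded_op B, adj (N i) B
    & N i \o B = B \o N i] by move=> i; have [_] := nN i.
have bN i : bounded_op (N i) by have [] := nN i.
have bN' i : bounded_op (N' i) by have [] := hN' i.
have aN i : adj (N i) (N' i) by have [] := hN' i.
have NN i j x : N i (N j x) = N j (N i x) by have := congr1 (@^~ x) (cN i j).
have NN' i j x : N' i (N j x) = N j (N' i x).
  have [lN [C1 C10 b1]] := (bounded_opP (N i)).1 (bN i).
  have [lN' _] := (bounded_opP (N' i)).1 (bN' i).
  have b2 : opbound C1 (N' i) by apply: opbound_adj (aN i) b1; exact: ltW.
  apply: (Fuglede lN lN' b1 b2 (aN i)) => //; last exact: ltW.
  by move=> y; have [_ _ /(congr1 (@^~ y))] := hN' i.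
have N'N' i j x : N' i (N' j x) = N' j (N' i x).
  by apply: dot_inj => z; rewrite -!aN NN.
exists N'; split=> //.
- by move=> A [[i _ <-]|[i _ <-]].
- by move=> A B x [[i _ <-]|[i _ <-]] [[j _ <-]|[j _ <-]].
move=> i x; apply: (@pexpIrn _ 2) => //; rewrite ?nnegrE ?nrm_ge0// !nrm_sqr /rdot.
by rewrite -aN -NN' (adj_sym (aN i)).
Qed.

(* A real polynomial inequality valid on the joint spectrum persists for the operators:
   otherwise the self-adjoint operator [S] below, extended to a joint approximate
   eigenvalue of all the [N j], violates the inequality at a point of the spectrum. *)
Lemma normal_tuple_ineq (K : set 'rV[R[i]]_d) (a : 'I_d -> R[i]) (c : R)
    (i : 'I_d) (b : R[i]) : normal_tuple N -> joint_spectrum N `<=` K ->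
  (forall z, K z -> absc (z 0 i - b) ^+ 2 <= Re (\sum_j a j * z 0 j) + c) ->
  forall u : L, nrm (N i u - b *: u) ^+ 2 <=
    Re (\sum_j a j * dot (N j u) u) + c * nrm u ^+ 2.
Proof.
move=> nN sK hK u; have [N' [bG aN cG nE]] := normal_tuple_adjoints nN.
set G := star_gen N' in bG cG.
have gN j : op_alg G (N j) by apply: op_alg_gen; left; exists j.
have gN' j : op_alg G (N' j) by apply: op_alg_gen; right; exists j.
(* [P] is [N i - b], and [F + F'] is the real part of [\sum_j a j N j]. Thus [<S x, x>] is the right
   side minus the left side of the claim at [x]. *)
pose P : L -> L := (- b) *: (@id L) + N i.
pose P' : L -> L := (- b)^* *: (@id L) + N' i.
pose F : L -> L := \sum_j (2^-1 * a j) *: N j.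
pose F' : L -> L := \sum_j (2^-1 * (a j)^*) *: N' j.
pose S : L -> L := (-1) *: (P' \o P) + (c%:C *: (@id L) + (1 *: F + F')).
have gP : op_alg G P by apply: op_alg_lin => //; exact: op_alg_id.
have gP' : op_alg G P' by apply: op_alg_lin => //; exact: op_alg_id.
have gF : op_alg G F by apply: op_alg_sum => j; exact: op_alg_scale.
have gF' : op_alg G F' by apply: op_alg_sum => j; exact: op_alg_scale.
have gS : op_alg G S.
  apply: op_alg_lin; first exact: op_alg_comp.
  by apply: op_alg_lin; [exact: op_alg_id|exact: op_alg_lin].
have PP' : adj P P' by apply: adj_lin.
have conj2 : (2^-1 : R[i])^* = 2^-1 by rewrite fmorphV rmorph_nat.
have FF' : adj F F'.
  move=> x y; rewrite /F /F' !fct_sumE dot_suml dot_sumr; apply: eq_bigr => j _.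
  by rewrite !fctE dotZl dotZr aN rmorphM /= conjCK conj2.
have SE x : S x = c%:C *: x + (F x + F' x) - P' (P x).
  by rewrite /S !fctE scaleN1r scale1r addrC.
have sS : selfadj S.
  split; first exact: op_alg_bounded gS.
  move=> x y.
  have q1 : dot (P' (P x)) y = dot x (P' (P y)) by rewrite (adj_sym PP') PP'.
  have q2 : dot (F x) y + dot (F' x) y = dot x (F y) + dot x (F' y).
    by rewrite FF' (adj_sym FF') addrC.
  rewrite !SE dotBl dotBr q1; congr (_ - _).
  rewrite dotDl dotDr dotZl dotZr conj_realE; congr (_ + _).
  by rewrite dotDl dotDr.
have rS x : rdot (S x) x =
    Re (\sum_j a j * dot (N j x) x) + c * nrm x ^+ 2 - nrm (P x) ^+ 2.
  rewrite SE rdotBl rdotDl rdotZl [rdot (_ + _) _]rdotDl nrm_sqr.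
  have -> : rdot (P' (P x)) x = nrm (P x) ^+ 2.
    by rewrite nrm_sqr /rdot (adj_sym PP').
  have -> : rdot (F' x) x = rdot (F x) x.
    by rewrite rdotC /rdot -FF'.
  suff -> : Re (\sum_j a j * dot (N j x) x) = 2 * rdot (F x) x by ring.
  rewrite -[RHS]Re_realM /F fct_sumE dot_suml mulr_sumr; congr Re.
  apply: eq_bigr => j _; rewrite fctE dotZl !mulrA; congr (_ * _).
  by rewrite rmorph_nat mulfV ?mul1r// pnatr_eq0.
have PE x : P x = N i x - b *: x by rewrite /P !fctE scaleNr addrC.
rewrite -PE leNgt; apply/negP => lt0.
have u0 : u != 0.
  apply: contraTneq lt0 => ->; have [lP _] := (bounded_opP P).1 (op_alg_bounded bG gP).
  rewrite lin0// nrm0 expr0n mulr0 addr0 big1 ?ltxx// => j _.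
  by rewrite dot0r mulr0.
(* If the claim fails at [u], then [A0] is positive there, and [joint_approx_eigen] keeps its
   approximate eigenvalue positive. *)
pose A0 := (-1) *: S.
have gA0 : op_alg G A0 by exact: op_alg_scale.
have sA0 : selfadj A0.
  split; first exact: op_alg_bounded gA0.
  by move=> x y; rewrite /A0 !fctE !scaleN1r dotNl dotNr sS.2.
(* Real and imaginary parts of [N j]; their approximate eigenvalues are the two parts of
   [mu 0 j]. *)
pose Ar j : L -> L := 2^-1 *: N j + 2^-1 *: N' j.
pose Ai j : L -> L := (- 'i%C / 2) *: N j + ('i%C / 2) *: N' j.
have gAr j : op_alg G (Ar j) by apply: op_alg_lin => //; exact: op_alg_scale.
have gAi j : op_alg G (Ai j) by apply: op_alg_lin => //; exact: op_alg_scale.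
have conji : ('i%C : R[i])^* = - 'i%C by apply: complex_eqP; rewrite /= ?oppr0.
have ci2 : ('i%C / 2 : R[i])^* = - 'i%C / 2 by rewrite rmorphM /= conj2 conji.
have ci1 : (- 'i%C / 2 : R[i])^* = 'i%C / 2 by rewrite -ci2 conjCK.
have sAr j : selfadj (Ar j).
  split; first exact: op_alg_bounded (gAr j).
  move=> x y; rewrite /Ar !fctE dotDl dotDr !dotZl !dotZr aN (adj_sym (aN j)).
  by rewrite conj2 addrC.
have sAi j : selfadj (Ai j).
  split; first exact: op_alg_bounded (gAi j).
  move=> x y; rewrite /Ai !fctE dotDl dotDr !dotZl !dotZr aN (adj_sym (aN j)).
  by rewrite ci1 ci2 addrC.
pose l := [seq Ar j | j <- enum 'I_d] ++ [seq Ai j | j <- enum 'I_d].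
have lP A : A \in l -> op_alg G A /\ selfadj A.
  by rewrite mem_cat => /orP[] /mapP[j _ ->].
have [||||al [al0 hal]] := @joint_approx_eigen R L l A0 ((nrm u)^-1%:C *: u) sA0.
- by move=> A /lP[].
- by move=> A y /lP[gA _]; exact: (op_alg_comm bG cG y gA0 gA).
- by move=> A B y /lP[gA _] /lP[gB _]; exact: (op_alg_comm bG cG y gA gB).
- exact: nrm_unit.
have {}al0 : 0 < al A0.
  apply: lt_le_trans al0; have [lA _] := (bounded_opP A0).1 sA0.1.
  rewrite (linZ lA) rdotZl rdotZr !mulr_gt0 ?invr_gt0 ?nrm_gt0//.
  by rewrite /A0 fctE scaleN1r rdotNl rS oppr_gt0 subr_lt0.
have /choice[x hx] : forall n : nat, exists x, approx_eigen (A0 :: l) al n.+1%:R^-1 x.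
  by move=> n; apply: hal; rewrite invr_gt0 ltr0n.
have x1 n : nrm (x n) = 1 by have [] := hx n.
have act A : A \in A0 :: l -> acts x A (al A)%:C.
  move=> Al e /invSn_lt[M hM]; exists M => n /hM; apply: le_lt_trans.
  by have [_ ] := hx n; apply.
have aAr j : acts x (Ar j) (al (Ar j))%:C.
  by apply: act; rewrite inE mem_cat map_f ?orbT// mem_enum.
have aAi j : acts x (Ai j) (al (Ai j))%:C.
  by apply: act; rewrite inE mem_cat [X in _ || X]orbC map_f ?orbT// mem_enum.
pose mu : 'rV[R[i]]_d := \row_j (Complex (al (Ar j)) (al (Ai j))).
have half : 2^-1 + 2^-1 = 1 :> R[i] by rewrite [RHS]splitr mul1r.
have aN1 j : acts x (N j) (mu 0 j).
  have -> : N j = 'i%C *: Ai j + Ar j.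
    apply/funext => y; rewrite /Ai /Ar !fctE scalerDr !scalerA !mulrA mulrN -expr2 sqr_i.
    rewrite opprK mul1r mulN1r addrACA scaleNr addNr addr0 -scalerDl.
    by rewrite half scale1r.
  have -> : mu 0 j = 'i%C * (al (Ai j))%:C + (al (Ar j))%:C.
    by rewrite mxE; apply: complex_eqP => /=; ring.
  exact: acts_lin.
have aN1' j : acts x (N' j) (mu 0 j)^*.
  have -> : N' j = (- 'i%C) *: Ai j + Ar j.
    apply/funext => y; rewrite /Ai /Ar !fctE scalerDr !scalerA !mulrA mulrNN mulNr.
    rewrite -expr2 sqr_i opprK mul1r mulN1r addrACA scaleNr addNr add0r -scalerDl.
    by rewrite half scale1r.
  have -> : (mu 0 j)^* = (- 'i%C) * (al (Ai j))%:C + (al (Ar j))%:C.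
    by rewrite mxE; apply: complex_eqP => /=; ring.
  exact: acts_lin.
have muK : K mu.
  apply/sK/(approx_joint_spectrum x1 (T' := N')) => // j; apply: bG; [left|right]; by exists j.
have aP : acts x P (- b + mu 0 i).
  by rewrite -[- b]mulr1; apply: acts_lin => //; exact: acts_id.
have aP' : acts x P' (- b + mu 0 i)^*.
  by have := acts_lin (- b)^* (acts_id x) (aN1' i); rewrite mulr1 -rmorphD.
pose f := \sum_j 2^-1 * a j * mu 0 j.
have aF : acts x F f by apply: acts_sum => j; exact: acts_scale.
have aF' : acts x F' f^*.
  rewrite /f rmorph_sum /=; apply: acts_sum => j.
  by rewrite !rmorphM /= conj2; exact: acts_scale.
have bP' : bounded_op P' by exact: op_alg_bounded gP'.
(* The eigenvalue of [S] computed from [mu] must agree with [- al A0 < 0], which contradicts [hK] at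
   [mu]. *)
have aS := acts_lin (-1) (acts_comp bP' aP' aP)
  (acts_lin c%:C (acts_id x) (acts_lin 1 aF aF')).
have := acts_scale (-1) aS.
rewrite -/S -/A0 => /(acts_uniq x1)/(_ (act _ (mem_head _ _)))/(congr1 (@complex.Re R)).
rewrite Re_real => alE; rewrite -alE in al0.
move: (hK _ muK); rewrite leNgt => /negP; apply; move: al0.
have -> : - b + mu 0 i = mu 0 i - b by rewrite addrC.
rewrite [X in -1 * X + _]mulrC absc_mulJ mulrDr mulr1 !mulN1r opprK opprD addrA.
have -> : Re (\sum_j a j * mu 0 j) = Re (1 * f + f^*).
  rewrite mul1r ReD ReJ /f; under [in RHS]eq_bigr do rewrite -mulrA.
  rewrite -mulr_sumr; set s := \sum_j _.
  have -> : (2^-1 : R[i]) = (2^-1)%:C by rewrite fmorphV rmorph_nat.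
  by rewrite Re_realM; field.
by rewrite !(ReD, ReN) !Re_real => h; lra.
Qed.

End NormalTuples.

(** * Affine majorants at extreme points *)

Section ConvexGeometry.
Variables (R : realType) (d : nat).
Notation V := 'rV[R[i]]_d.
Implicit Types (z w : V) (f g : V -> R).

Definition real_affine f := exists (a : 'I_d -> R[i]) (c : R),
  forall z, f z = Re (\sum_j a j * z 0 j) + c.

Lemma real_affineD f g : real_affine f -> real_affine g -> real_affine (f \+ g).
Proof.
move=> [a [c fE]] [b [e gE]]; exists (fun j => a j + b j), (c + e) => z.
rewrite /= fE gE; under [in RHS]eq_bigr do rewrite mulrDl.
by rewrite big_split /= ReD addrACA.
Qed.

Lemma real_affineZ (r : R) f : real_affine f -> real_affine (fun z => r * f z).
Proof.
move=> [a [c fE]]; exists (fun j => r%:C * a j), (r * c) => z.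
under eq_bigr do rewrite -mulrA.
by rewrite -mulr_sumr Re_realM fE mulrDr.
Qed.

Lemma real_affine_sum (I : finType) (F : I -> V -> R) :
  (forall i, real_affine (F i)) -> real_affine (fun z => \sum_i F i z).
Proof.
move=> aF; rewrite -[X in real_affine X]/(fun z => \sum_(i <- index_enum I) F i z).
elim: (index_enum I) => [|i s IHs].
  by exists (fun=> 0), 0 => z; rewrite big_nil big1 ?add0r// => j _; rewrite mul0r.
have -> : (fun z => \sum_(j <- i :: s) F j z) = F i \+ (fun z => \sum_(j <- s) F j z).
  by apply/funext => z; rewrite big_cons.
exact: real_affineD.
Qed.

(** The Euclidean inner product of C^d regarded as R^(2d). *)
Definition vdot z w : R := \sum_j (Re (z 0 j) * Re (w 0 j) + Im (z 0 j) * Im (w 0 j)).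

Lemma vdotDl z1 z2 w : vdot (z1 + z2) w = vdot z1 w + vdot z2 w.
Proof. by rewrite -big_split /=; apply: eq_bigr => j _; rewrite !mxE ReD ImD; ring. Qed.
Lemma vdotZl (r : R) z w : vdot (r%:C *: z) w = r * vdot z w.
Proof.
rewrite mulr_sumr; apply: eq_bigr => j _; rewrite !mxE Re_realM Im_mul Im_real Re_real; ring.
Qed.
Lemma vdotC z w : vdot z w = vdot w z.
Proof. by apply: eq_bigr => j _; ring. Qed.
Lemma vdotNl z w : vdot (- z) w = - vdot z w.
Proof. by rewrite -sumrN; apply: eq_bigr => j _; rewrite !mxE ReN ImN; ring. Qed.
Lemma vdotDr z w1 w2 : vdot z (w1 + w2) = vdot z w1 + vdot z w2.
Proof. by rewrite vdotC vdotDl !(vdotC z). Qed.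
Lemma vdotNr z w : vdot z (- w) = - vdot z w.
Proof. by rewrite vdotC vdotNl (vdotC z). Qed.
Lemma vdotZr (r : R) z w : vdot z (r%:C *: w) = r * vdot z w.
Proof. by rewrite vdotC vdotZl (vdotC z). Qed.
Lemma vdot_ge0 z : 0 <= vdot z z.
Proof. by apply: sumr_ge0 => j _; rewrite addr_ge0// -expr2 sqr_ge0. Qed.
Lemma vdot_eq0 z : vdot z z <= 0 -> z = 0.
Proof.
move=> z0; have : vdot z z == 0 by rewrite eq_le z0 vdot_ge0.
rewrite psumr_eq0 => [/allP h|j _]; last by rewrite addr_ge0// -expr2 sqr_ge0.
apply/rowP => j; rewrite mxE; have := h j (mem_index_enum _).
rewrite /= -!expr2 paddr_eq0 ?sqr_ge0// !sqrf_eq0 => /andP[/eqP ? /eqP ?].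
exact: complex_eqP.
Qed.

Lemma real_affine_vdot w (c : R) : real_affine (fun z => vdot w z + c).
Proof.
exists (fun j => (w 0 j)^*), c => z; congr (_ + _); rewrite Re_sum.
by apply: eq_bigr => j _; rewrite Re_mul ReJ ImJ; ring.
Qed.

Lemma continuous_real_sum (T : topologicalType) (I : Type) (s : seq I) (F : I -> T -> R) :
  (forall i, continuous (F i)) -> continuous (fun x => \sum_(i <- s) F i x).
Proof.
move=> cF; elim: s => [|i s IHs].
  have -> : (fun x => \sum_(j <- [::]) F j x) = cst 0.
    by apply/funext => x; rewrite big_nil.
  by move=> x; exact: cvg_cst.
have -> : (fun x => \sum_(j <- i :: s) F j x) = F i \+ (fun x => \sum_(j <- s) F j x).
  by apply/funext => x; rewrite big_cons.
by move=> x; apply: cvgD; [exact: cF|exact: IHs].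
Qed.

Lemma continuous_Re : continuous (@complex.Re R : R[i] -> R).
Proof.
move=> z; apply/(@cvgrPdist_lt _ _ _ (nbhs z)) => e e0; apply/nbhs_ballP; exists e%:C => /=.
  by rewrite ltcR.
move=> y; rewrite -ball_normE => zy; have : (absc (z - y))%:C < e%:C.
  by rewrite -normcEabs; exact: zy.
by rewrite ltcR -ReB; exact: le_lt_trans (Re_le_absc _).
Qed.

Lemma continuous_Im : continuous (@complex.Im R : R[i] -> R).
Proof.
move=> z; apply/(@cvgrPdist_lt _ _ _ (nbhs z)) => e e0; apply/nbhs_ballP; exists e%:C => /=.
  by rewrite ltcR.
move=> y; rewrite -ball_normE => zy; have : (absc (z - y))%:C < e%:C.
  by rewrite -normcEabs; exact: zy.
by rewrite ltcR -ImB; exact: le_lt_trans (Im_le_absc _).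
Qed.

Lemma continuous_Re_coord j : continuous (fun z => Re (z 0 j)).
Proof.
move=> z; apply: (@continuous_comp V R[i] R (fun z => z 0 j) (@complex.Re R)).
  exact: coord_continuous.
exact: continuous_Re.
Qed.

Lemma continuous_Im_coord j : continuous (fun z => Im (z 0 j)).
Proof.
move=> z; apply: (@continuous_comp V R[i] R (fun z => z 0 j) (@complex.Im R)).
  exact: coord_continuous.
exact: continuous_Im.
Qed.

Lemma convexW (K : set V) z w (s t : R) : convex_set K -> K z -> K w ->
  0 <= s -> 0 <= t -> s + t = 1 -> K (s%:C *: z + t%:C *: w).
Proof.
move=> cK Kz Kw s0 t0 st.
have [s00|s00] := eqVneq s 0.
  by move: st; rewrite s00 add0r => ->; rewrite scale0r add0r scale1r.
have [t00|t00] := eqVneq t 0.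
  by move: st; rewrite t00 addr0 => ->; rewrite scale0r addr0 scale1r.
have tE : t%:C = 1 - s%:C :> R[i] by apply: complex_eqP => /=; lra.
have s1 : s <= 1 by rewrite -st lerDl.
have cs0 : (0 : R[i]) <= s%:C by rewrite lecR.
have cs1 : s%:C <= (1 : R[i]) by rewrite -[1]/(1%:C) lecR.
have := cK z w (Itv01 cs0 cs1); rewrite !inE tE; exact.
Qed.

(* Dividing by [p + q] is avoided, so that [p = q = 0] needs no special treatment. *)
Lemma convex_cone (K : set V) z w (p q : R) : convex_set K -> K z -> K w ->
  0 <= p -> 0 <= q -> exists2 v, K v & (p + q)%:C *: v = p%:C *: z + q%:C *: w.
Proof.
move=> cK Kz Kw p0 q0; have [pq0|pq0] := eqVneq (p + q) 0.
  have p00 : p = 0 by lra.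
  have q00 : q = 0 by lra.
  by exists z; rewrite ?p00 ?q00 ?addr0 ?scale0r ?addr0.
have pq : 0 < p + q by rewrite lt_neqAle eq_sym pq0 addr_ge0.
exists ((p / (p + q))%:C *: z + (q / (p + q))%:C *: w).
  apply: convexW => //; last by rewrite -mulrDl divff.
    exact: divr_ge0 p0 (ltW pq).
  exact: divr_ge0 q0 (ltW pq).
by rewrite scalerDr !scalerA -!rmorphM/= !(mulrCA (p + q)) divff// !mulr1.
Qed.

(* A nearest point of the convex hull [C] of the graphs of [0] and [g] over [K] to
   the point [(la, eps)], which is outside [C] because [la] is extreme. *)
Lemma extreme_affine_majorant (K : set V) la g (eps : R) :
  compact K -> convex_set K -> extreme_points K la -> real_affine g -> g la = 0 -> 0 < eps ->
  exists f, [/\ real_affine f, forall z, K z -> 0 <= f z,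
    forall z, K z -> g z <= f z & f la < eps].
Proof.
move=> cpK cvK [Kla ext] ag gla eps0.
(* Both graphs are convex, so one point of each and a weight [t] in [0, 1] parametrize the hull:
   [(z1, z2, t)] stands for the point [t z1 + (1 - t) z2] at height [t g(z1)]. [Phi] is the squared
   distance to [(la, eps)]. *)
pose X := ((V * V) * R)%type.
pose pt (x : X) : V := x.2%:C *: x.1.1 + (1 - x.2)%:C *: x.1.2.
pose ht (x : X) : R := x.2 * g x.1.1.
pose Phi (x : X) := vdot (la - pt x) (la - pt x) + (eps - ht x) ^+ 2.
have cRe (j : 'I_d) : continuous (fun x : X => Re (x.1.1 0 j)).
  move=> x; apply: (@continuous_comp X V R (fun x => x.1.1) (fun z => Re (z 0 j))).
    by apply: (@continuous_comp X (V * V)%type V fst fst); [exact: cvg_fst|exact: cvg_fst].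
  exact: continuous_Re_coord.
have cIm (j : 'I_d) : continuous (fun x : X => Im (x.1.1 0 j)).
  move=> x; apply: (@continuous_comp X V R (fun x => x.1.1) (fun z => Im (z 0 j))).
    by apply: (@continuous_comp X (V * V)%type V fst fst); [exact: cvg_fst|exact: cvg_fst].
  exact: continuous_Im_coord.
have cRe2 (j : 'I_d) : continuous (fun x : X => Re (x.1.2 0 j)).
  move=> x; apply: (@continuous_comp X V R (fun x => x.1.2) (fun z => Re (z 0 j))).
    by apply: (@continuous_comp X (V * V)%type V fst snd); [exact: cvg_fst|exact: cvg_snd].
  exact: continuous_Re_coord.
have cIm2 (j : 'I_d) : continuous (fun x : X => Im (x.1.2 0 j)).
  move=> x; apply: (@continuous_comp X V R (fun x => x.1.2) (fun z => Im (z 0 j))).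
    by apply: (@continuous_comp X (V * V)%type V fst snd); [exact: cvg_fst|exact: cvg_snd].
  exact: continuous_Im_coord.
have ct : continuous (fun x : X => x.2) by move=> x; exact: cvg_snd.
have [a [c gE]] := ag.
have gE2 z : g z = \sum_j (Re (a j) * Re (z 0 j) - Im (a j) * Im (z 0 j)) + c.
  by rewrite gE Re_sum; congr (_ + _); apply: eq_bigr => j _; rewrite Re_mul.
have cPhi : continuous Phi.
  have -> : Phi = fun x : X => \sum_j
      ((Re (la 0 j) - (x.2 * Re (x.1.1 0 j) + (1 - x.2) * Re (x.1.2 0 j))) ^+ 2 +
       (Im (la 0 j) - (x.2 * Im (x.1.1 0 j) + (1 - x.2) * Im (x.1.2 0 j))) ^+ 2) +
      (eps - x.2 * (\sum_j (Re (a j) * Re (x.1.1 0 j) - Im (a j) * Im (x.1.1 0 j)) + c)) ^+ 2.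
    apply/funext => x; rewrite /Phi /ht gE2; congr (_ + _); apply: eq_bigr => j _.
    rewrite /pt !mxE !(ReB, ImB, ReD, ImD, Re_realM, Im_mul) !Re_real !Im_real.
    by rewrite !mul0r !addr0 !expr2.
  move=> x; apply: cvgD.
    apply: continuous_real_sum => j {}x; apply: cvgD; (apply: cvgM;
    (apply: cvgB; [exact: cvg_cst|apply: cvgD; apply: cvgM]));
    by [exact: ct|exact: cRe|exact: cIm|exact: cRe2|exact: cIm2|apply: cvgB; [exact: cvg_cst|exact: ct]].
  have h : (fun y : X => eps - y.2 * (\sum_j (Re (a j) * Re (y.1.1 0 j) -
      Im (a j) * Im (y.1.1 0 j)) + c)) y @[y --> x] -->
      eps - x.2 * (\sum_j (Re (a j) * Re (x.1.1 0 j) - Im (a j) * Im (x.1.1 0 j)) + c).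
    apply: cvgB; first exact: cvg_cst.
    apply: cvgM; first exact: ct.
    apply: cvgD; last exact: cvg_cst.
    apply: continuous_real_sum => j {}x; apply: cvgB; apply: cvgM; by [exact: cvg_cst|exact: cRe|exact: cIm].
  exact: (cvgM h h).
pose D : set X := (K `*` K) `*` [set` `[0 : R, 1]].
have D0 : D !=set0 by exists ((la, la), 0); rewrite /D /= in_itv /= lexx ler01.
have cD : compact D by apply: compact_setX; [exact: compact_setX|exact: segment_compact].
have [x /set_mem[[K1 K2] /=] + xmin] := compact_EVT_min D0 cD (continuous_subspaceT cPhi).
rewrite in_itv /= => /andP[t0 t1].
pose s := ht x.
(* The obtuse-angle condition at the nearest point, towards any [(z, r)] whose segment to that point
   stays in the hull. It is then applied with [r = 0] and with [r = g z]. *)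
have var z (r : R) : (forall w : R, 0 <= w <= 1 -> exists2 y, D y &
    pt y = (1 - w)%:C *: pt x + w%:C *: z /\ ht y = (1 - w) * s + w * r) ->
    vdot (la - pt x) (z - pt x) + (eps - s) * (r - s) <= 0.
  move=> hy; set q := _ + _; pose n := vdot (z - pt x) (z - pt x) + (r - s) ^+ 2.
  have n0 : 0 <= n by rewrite addr_ge0 ?vdot_ge0 ?sqr_ge0.
  have key (w : R) : 0 <= w <= 1 -> 2 * w * q <= w ^+ 2 * n.
    move=> w01; have [y Dy [ptE htE]] := hy w w01.
    have := xmin y (mem_set Dy); rewrite /Phi ptE htE -/s.
    have -> : la - ((1 - w)%:C *: pt x + w%:C *: z) = (la - pt x) - w%:C *: (z - pt x).
      rewrite rmorphB rmorph1 scalerBl scale1r scalerBr !opprD !opprK !addrA.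
      by rewrite addrAC.
    rewrite /q /n; move: (la - pt x) (z - pt x) => A B.
    by rewrite !(vdotDl, vdotDr, vdotNl, vdotNr, vdotZl, vdotZr) (vdotC B A); nra.
  rewrite leNgt; apply/negP => q0.
  pose w := Num.min 1 (q / (n + 1)).
  have n1 : 0 < n + 1 by lra.
  have w0 : 0 < w by rewrite lt_min ltr01 divr_gt0.
  have w1 : w <= 1 by rewrite ge_min lexx.
  have wq : w * (n + 1) <= q by rewrite -ler_pdivlMr// ge_min lexx orbT.
  have := key w; rewrite (ltW w0) w1 => /(_ isT).
  have -> : 2 * w * q = w * (2 * q) by ring.
  by rewrite expr2 -mulrA ler_pM2l//; nra.
have var0 z : K z -> vdot (la - pt x) (z - pt x) + (eps - s) * (0 - s) <= 0.
  move=> Kz; apply: var => w /andP[w0 w1].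
  have a0 : 0 <= (1 - w) * (1 - x.2) by rewrite mulr_ge0 ?subr_ge0.
  have [k Kk kE] := convex_cone cvK K2 Kz a0 w0.
  exists ((x.1.1, k), (1 - w) * x.2).
    split=> //=; rewrite in_itv /= mulr_ge0 ?subr_ge0//=.
    have : (1 - w) * x.2 <= (1 - w) * 1 by rewrite ler_wpM2l ?subr_ge0.
    lra.
  split; last by rewrite /ht /s /ht /= mulr0 addr0 mulrA.
  rewrite /pt /=; have -> : 1 - (1 - w) * x.2 = (1 - w) * (1 - x.2) + w by ring.
  by rewrite kE scalerDr !scalerA -!rmorphM addrA.
have var1 z : K z -> vdot (la - pt x) (z - pt x) + (eps - s) * (g z - s) <= 0.
  move=> Kz; apply: var => w /andP[w0 w1].
  have a0 : 0 <= (1 - w) * x.2 by rewrite mulr_ge0 ?subr_ge0.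
  have [k Kk kE] := convex_cone cvK K1 Kz a0 w0.
  exists ((k, x.1.2), (1 - w) * x.2 + w).
    split=> //=; rewrite in_itv /= addr_ge0//=.
    have : (1 - w) * x.2 <= (1 - w) * 1 by rewrite ler_wpM2l ?subr_ge0.
    lra.
  split.
    rewrite /pt /= kE; have -> : 1 - ((1 - w) * x.2 + w) = (1 - w) * (1 - x.2) by ring.
    by rewrite scalerDr !scalerA -!rmorphM addrAC.
  rewrite /ht /s /ht /=; have [b [e hE]] := ag; rewrite !hE.
  rewrite mulrDr -Re_realM mulr_sumr.
  have -> : \sum_j ((1 - w) * x.2 + w)%:C * (b j * k 0 j) =
      \sum_j b j * (((1 - w) * x.2 + w)%:C *: k) 0 j.
    by apply: eq_bigr => j _; rewrite !mxE mulrCA.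
  rewrite kE; under eq_bigr => j _ do rewrite !mxE mulrDr mulrCA (mulrCA (b j)).
  by rewrite big_split /= -!mulr_sumr ReD !Re_realM; ring.
have h0 := var0 la Kla; have vv := vdot_ge0 (la - pt x).
have s0 : 0 <= s * (eps - s) by lra.
(* From [h0], [0 <= s <= eps]. If [s = eps], then [la = pt x], and extremality gives weight 0 or
   [x.1.1 = la]; either way the height [s] is 0, contradicting [0 < eps]. *)
have beta : 0 < eps - s.
  rewrite subr_gt0 lt_neqAle; apply/andP; split; last by nra.
  apply/eqP => sE; have laE : la = pt x.
    by apply/subr0_eq/vdot_eq0; rewrite sE in h0; lra.
  suff : s = 0 by lra.
  have [t00|t00] := eqVneq x.2 0; first by rewrite /s /ht t00 mul0r.
  suff k1 : x.1.1 = la by rewrite /s /ht k1 gla mulr0.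
  have [t11|t11] := eqVneq x.2 1.
    by rewrite laE /pt t11 subrr scale0r addr0 scale1r.
  have tc : (0 : R[i]) < x.2%:C < 1.
    by rewrite -[1]/(1%:C) !ltcR !lt_neqAle t0 t1 t11 eq_sym t00.
  have [|//] := ext _ _ _ K1 K2 tc.
  by rewrite {1}laE /pt rmorphB.
(* The supporting hyperplane at the nearest point, solved for the height; [beta] says that it is not
   vertical. *)
exists (fun z => vdot ((- (eps - s)^-1)%:C *: (la - pt x)) z +
   (s + (eps - s)^-1 * vdot (la - pt x) (pt x))).
have fE z : vdot ((- (eps - s)^-1)%:C *: (la - pt x)) z +
   (s + (eps - s)^-1 * vdot (la - pt x) (pt x)) =
   s - (eps - s)^-1 * vdot (la - pt x) (z - pt x).
  by rewrite vdotZl [in RHS]vdotDr vdotNr; ring.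
have fub z (r : R) : vdot (la - pt x) (z - pt x) + (eps - s) * (r - s) <= 0 ->
    r <= s - (eps - s)^-1 * vdot (la - pt x) (z - pt x).
  set q := vdot _ _ => h; have e : (eps - s) * ((eps - s)^-1 * q) = q.
    by rewrite mulVKf// gt_eqF.
  by rewrite -(ler_pM2l beta) [leRHS]mulrBr e; lra.
split.
- exact: real_affine_vdot.
- by move=> z Kz; rewrite fE; exact/fub/var0.
- by move=> z Kz; rewrite fE; exact/fub/var1.
rewrite fE; have : 0 <= (eps - s)^-1 * vdot (la - pt x) (la - pt x).
  by rewrite mulr_ge0 ?vdot_ge0// invr_ge0 ltW.
lra.
Qed.

Lemma real_affine_coord (b : R[i]) (i : 'I_d) (e : R[i]) :
  real_affine (fun z => Re (b * (z 0 i - e))).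
Proof.
exists (fun j => if j == i then b else 0), (- Re (b * e)) => z.
rewrite (bigD1 i)//= eqxx big1 ?addr0 => [|j /negbTE ->]; last by rewrite mul0r.
by rewrite mulrBr ReB.
Qed.

Lemma compact_coord_bound (K : set V) : K !=set0 -> compact K -> exists2 B, 0 < B &
  forall z i, K z -> `|Re (z 0 i)| <= B /\ `|Im (z 0 i)| <= B.
Proof.
move=> K0 cK; have cv : continuous (fun z => vdot z z).
  apply: (@continuous_real_sum V 'I_d (index_enum _)
    (fun j z => Re (z 0 j) * Re (z 0 j) + Im (z 0 j) * Im (z 0 j))) => j z.
  have r := @continuous_Re_coord j z; have i := @continuous_Im_coord j z.
  exact: (cvgD (cvgM r r) (cvgM i i)).
have [z0 _ hz0] := compact_EVT_max K0 cK (continuous_subspaceT cv).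
exists (vdot z0 z0 + 1) => [|z i Kz]; first by rewrite ltr_wpDl ?vdot_ge0.
have h : Re (z 0 i) ^+ 2 + Im (z 0 i) ^+ 2 <= vdot z0 z0.
  apply: (le_trans _ (hz0 z (mem_set Kz))); rewrite /vdot (bigD1 i)//= !expr2 lerDl.
  by apply: sumr_ge0 => j _; rewrite addr_ge0// -expr2 sqr_ge0.
have b0 := vdot_ge0 z0; have r0 := sqr_ge0 (Re (z 0 i)); have i0 := sqr_ge0 (Im (z 0 i)).
by split; rewrite -(@ler_pXn2r _ 2)// ?nnegrE ?normr_ge0 ?addr_ge0// real_normK ?num_real//; nra.
Qed.

(** For a real number [t] with [|t| <= M], [t^2 <= M |t|]. So affine majorants of plus and minus the
    real and imaginary parts of [z_i - la_i], multiplied by a bound [M] for these parts on [K],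
    majorize [|z_i - la_i|^2]. *)
Lemma extreme_quadratic_majorant (K : set V) la (eps : R) :
  compact K -> convex_set K -> extreme_points K la -> 0 < eps ->
  exists F, [/\ real_affine F,
    forall z i, K z -> absc (z 0 i - la 0 i) ^+ 2 <= F z & F la < eps].
Proof.
move=> cK vK ela eps0; have Kla := ela.1.
have [B B0 hB] := compact_coord_bound (ex_intro _ la Kla) cK.
pose M := 2 * B; have M0 : 0 < M by rewrite mulr_gt0.
(* Four majorants for each coordinate, each multiplied by [M]. Dividing by [d + 1] makes the sum
   over [d] coordinates strictly less than [eps], also for [d = 0]. *)
pose e := eps / d.+1%:R / M / 4.
have d0 : 0 < d.+1%:R :> R by rewrite ltr0n.
have e0 : 0 < e by rewrite !divr_gt0.
have part i (b : R[i]) : exists f, [/\ real_affine f, forall z, K z -> 0 <= f z,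
    forall z, K z -> Re (b * (z 0 i - la 0 i)) <= f z & f la < e].
  apply: (extreme_affine_majorant cK vK ela (real_affine_coord b i (la 0 i))) => //.
  by rewrite subrr mulr0.
have /choice[F hF] : forall i, exists F, [/\ real_affine F,
    forall z, K z -> absc (z 0 i - la 0 i) ^+ 2 <= F z & F la < eps / d.+1%:R].
  move=> i; have [f1 [a1 p1 q1 l1]] := part i 1; have [f2 [a2 p2 q2 l2]] := part i (- 1).
  have [f3 [a3 p3 q3 l3]] := part i 'i%C; have [f4 [a4 p4 q4 l4]] := part i (- 'i%C).
  exists (fun z => M * ((f1 \+ f2) \+ (f3 \+ f4)) z); split.
  - by apply/real_affineZ/real_affineD; exact: real_affineD.
  - move=> z Kz; have := (p1 z Kz, p2 z Kz, p3 z Kz, p4 z Kz) => -[[[]]].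
    have := (q1 z Kz, q2 z Kz, q3 z Kz, q4 z Kz) => -[[[]]].
    rewrite mul1r !mulNr mul1r !ReN !Re_mul /= !mul0r !mul1r sub0r opprK absc_sqr.
    have [] := hB z i Kz; have [] := hB la i Kla; rewrite !ler_norml.
    move=> /andP[? ?] /andP[? ?] /andP[? ?] /andP[? ?].
    rewrite ReB ImB /M; set x := Re _ - _; set y := Im _ - _.
    move=> ? ? ? ? ? ? ? ?.
    have sq (t r : R) : - r <= t -> t <= r -> - M <= t -> t <= M -> t ^+ 2 <= M * r.
      move=> h1 h2 h3 h4; apply: le_trans (_ : M * `|t| <= _).
        by rewrite -real_normK ?num_real// expr2 ler_wpM2r// ler_norml h3.
      by rewrite ler_pM2l// ler_norml h1.
    have Mx : - M <= x /\ x <= M by rewrite /M /x; split; lra.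
    have My : - M <= y /\ y <= M by rewrite /M /y; split; lra.
    have x2 : x ^+ 2 <= M * (f1 z + f2 z) by apply: sq Mx.1 Mx.2; lra.
    have y2 : y ^+ 2 <= M * (f3 z + f4 z) by apply: sq My.1 My.2; lra.
    by rewrite -/M mulrDr lerD.
  - rewrite /= -ltr_pdivlMl//; have : M^-1 * (eps / d.+1%:R) = 4 * e.
      by rewrite /e; field; rewrite ?nat1r ?gt_eqF.
    by move=> ->; lra.
have F0 i z : K z -> 0 <= F i z.
  by move=> Kz; have [_ h _] := hF i; apply: (le_trans _ (h z Kz)); exact: sqr_ge0.
exists (fun z => \sum_i F i z); split.
- by apply: real_affine_sum => i; have [] := hF i.
- move=> z i Kz; have [_ /(_ z Kz) h _] := hF i; apply: le_trans h _.
  by rewrite (bigD1 i)//= lerDl; apply: sumr_ge0 => j _; exact: F0.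
apply: le_lt_trans (_ : \sum_(i < d) eps / d.+1%:R < _).
  by apply: ler_sum => i _; have [_ _ /ltW] := hF i.
rewrite sumr_const card_ord -[ltLHS]mulr_natr -mulrA -[ltRHS]mulr1 ltr_pM2l//.
by rewrite mulrC ltr_pdivrMr// mul1r ltr_nat.
Qed.

End ConvexGeometry.

(** * Compressions and states *)

Section Compression.
Variables (R : realType) (H : hilbertType R) (n : nat) (v : 'I_n -> H).
Hypothesis ortho_v : forall i j, dot (v i) (v j) = (i == j)%:R.

(** For orthonormal [v], the isometry from C^n onto the span of [v]; [coframe] is its adjoint, and
    [compression A] is the matrix of [coframe \o A \o frame]. *)
Definition frame (c : 'cV[R[i]]_n) : H := \sum_j c j 0 *: v j.
Definition coframe (y : H) : 'cV[R[i]]_n := \col_j dot y (v j).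
Definition compression (A : H -> H) : 'M[R[i]]_n := \matrix_(j, k) dot (A (v k)) (v j).

Lemma coframe_adj y c : cdot (coframe y) c = dot y (frame c).
Proof.
by rewrite dot_sumr; apply: eq_bigr => j _; rewrite mxE dotZr mulrC.
Qed.

Lemma frame_iso c e : dot (frame c) (frame e) = cdot c e.
Proof.
rewrite -coframe_adj; apply: eq_bigr => j _; rewrite mxE dot_suml (bigD1 j)//= big1.
  by rewrite dotZl ortho_v eqxx mulr1 addr0.
by move=> k /negbTE kj; rewrite dotZl ortho_v kj mulr0.
Qed.

Lemma compression_mul A c : linear A -> compression A *m c = coframe (A (frame c)).
Proof.
move=> lA; apply/colP => j; rewrite !mxE.
have -> : A (frame c) = \sum_k c k 0 *: A (v k).
  rewrite /frame (big_morph A (linD lA) (lin0 lA)); apply: eq_bigr => k _.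
  by rewrite linZ.
by rewrite dot_suml; apply: eq_bigr => k _; rewrite mxE dotZl mulrC.
Qed.

Lemma compression_ucp : ucp compression.
Proof.
split.
- move=> a A B _ _; apply/matrixP => j k.
  by rewrite !mxE !fctE dotDl dotZl.
- by apply/matrixP => j k; rewrite !mxE ortho_v eq_sym.
move=> k A bA pA x; have := pA (fun i => frame (x i)).
suff -> : \sum_i \sum_j dot (A i j (frame (x j))) (frame (x i)) =
    \sum_i \sum_j cdot (compression (A i j) *m x j) (x i) by [].
apply: eq_bigr => i _; apply: eq_bigr => j _.
by rewrite compression_mul ?coframe_adj//; have [] := (bounded_opP _).1 (bA i j).
Qed.

End Compression.

Section TwoVectors.
Variables (R : realType) (H : hilbertType R).

(** Gram-Schmidt; the dimension is 1 when [y] is a multiple of [x], and 2 otherwise. *)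
Lemma orthonormal_pair (x y : H) : nrm x = 1 ->
  exists n, [/\ (0 < n)%N & exists v : 'I_n -> H,
    (forall i j, dot (v i) (v j) = (i == j)%:R) /\
    exists c e, x = frame v c /\ y = frame v e].
Proof.
move=> x1; have xx : dot x x = 1 by rewrite dotxx -nrm_sqr x1 expr1n.
pose r := y - dot y x *: x; have [r0|r0] := eqVneq r 0.
  exists 1%N; split=> //; exists (fun=> x); split.
    by move=> i j; rewrite xx !ord1 eqxx.
  exists (const_mx 1), (const_mx (dot y x)); rewrite /frame !big_ord1 !mxE scale1r.
  by split=> //; apply/subr0_eq.
have rn : nrm r != 0 by rewrite nrm_eq0.
pose w := (nrm r)^-1%:C *: r; have ww : dot w w = 1.
  by rewrite dotxx -nrm_sqr nrm_unit// expr1n.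
have rx : dot r x = 0 by rewrite dotBl dotZl xx mulr1 subrr.
have wx : dot w x = 0 by rewrite dotZl rx mulr0.
have xw : dot x w = 0 by rewrite dotC wx rmorph0.
exists 2%N; split=> //; exists (fun i : 'I_2 => if i == 0%N :> nat then x else w); split.
  by case=> [[|[|i]] hi] [[|[|j]] hj].
exists (\col_i (i == 0%N :> nat)%:R),
  (\col_i (if i == 0%N :> nat then dot y x else (nrm r)%:C)).
rewrite /frame !big_ord_recl !big_ord0 !mxE /= scale1r scale0r !addr0; split=> //.
by rewrite scalerA -rmorphM/= divff// scale1r /r addrC subrK.
Qed.

(** Moving [N - b] to the other side yields its adjoint, which has the same norm at [u] as [N - b];
    then Cauchy-Schwarz applies. *)
Lemma adjoint_eigen_bound (N N' : H -> H) (b : R[i]) u w :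
  is_adjoint (@dot R H) (@dot R H) N N' -> nrm (N' u) = nrm (N u) ->
  absc (dot (N w - b *: w) u) <= nrm w * nrm (N u - b *: u).
Proof.
move=> a nE; have -> : dot (N w - b *: w) u = dot w (N' u - b^* *: u).
  by rewrite dotBl dotBr a dotZl dotZr conjCK.
apply: le_trans (dot_CS _ _) _; rewrite ler_wpM2l ?nrm_ge0//.
suff -> : nrm (N' u - b^* *: u) = nrm (N u - b *: u) by [].
apply: (@pexpIrn _ 2) => //; rewrite ?nnegrE ?nrm_ge0// !nrm_sqr !rdotBl !rdotBr.
have -> : rdot (N' u) (N' u) = rdot (N u) (N u) by rewrite -!nrm_sqr nE.
have -> : rdot (b^* *: u) (b^* *: u) = rdot (b *: u) (b *: u).
  by rewrite /rdot !dotZl !dotZr conjCK !mulrA (mulrC b).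
have h : rdot (N' u) (b^* *: u) = rdot (N u) (b *: u).
  rewrite /rdot !dotZr conjCK a [dot (N' u) u]dotC.
  by rewrite !Re_mul !ReJ !ImJ; ring.
by rewrite (rdotC (b^* *: u)) (rdotC (b *: u)) h.
Qed.

End TwoVectors.

Section CompactRange.
Variables (R : realType) (H : hilbertType R) (d : nat).
Variables (K : set 'rV[R[i]]_d) (T : 'I_d -> H -> H).
Hypotheses (K_compact : compact K) (K_convex : convex_set K).
Hypothesis T_bounded : forall i, bounded_op (T i).
Hypothesis T_range : forall n, (0 < n)%N -> matrix_range T n = wmin K n.

Definition vector_state (x : H) : 'rV[R[i]]_d := \row_j dot (T j x) x.

(** The compression of [T] to the span of [x] and [y] has a normal dilation [N], which reproduces
    all the inner products involved. There [normal_tuple_ineq] bounds [|(N_i - b_i) u|^2] by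
    [F (vector_state x)]; Cauchy-Schwarz gives the first estimate and [adjoint_eigen_bound] the
    second. *)
Lemma range_majorant_bound F (b : 'rV[R[i]]_d) i x y : real_affine F ->
  (forall z j, K z -> absc (z 0 j - b 0 j) ^+ 2 <= F z) -> nrm x = 1 ->
  absc (dot (T i x - b 0 i *: x) y) ^+ 2 <= nrm y ^+ 2 * F (vector_state x) /\
  absc (dot (T i y - b 0 i *: y) x) ^+ 2 <= nrm y ^+ 2 * F (vector_state x).
Proof.
move=> [a [c FE]] hF x1.
have [n [n0 [v [ov [c1 [e1 [xE yE]]]]]]] := orthonormal_pair y x1.
have : matrix_range T n (fun j => compression v (T j)).
  by exists (compression v) => //; exact: compression_ucp.
rewrite T_range// => -[L [N [nN sN [V [Vs [lV iV aV dV]]]]]].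
pose u := V c1; pose w := V e1.
have tr j (c' e' : 'cV[R[i]]_n) : dot (T j (frame v c')) (frame v e') = dot (N j (V c')) (V e').
  have [lT _] := (bounded_opP (T j)).1 (T_bounded j).
  rewrite -coframe_adj -compression_mul// dV.
  have -> : dot (N j (V c')) (V e') = (dot (V e') (N j (V c')))^* by rewrite dotC.
  rewrite aV /cdot rmorph_sum /=; apply: eq_bigr => k _.
  by rewrite rmorphM /= conjcE conjCK mulrC.
have ip (c' e' : 'cV[R[i]]_n) : dot (frame v c') (frame v e') = dot (V c') (V e').
  by rewrite frame_iso// iV.
have u1 : nrm u = 1 by rewrite -x1 xE /nrm /rdot ip.
have wy : nrm w = nrm y by rewrite yE /nrm /rdot ip.
have FN : nrm (N i u - b 0 i *: u) ^+ 2 <= F (vector_state x).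
  have := normal_tuple_ineq (c := c) (a := a) (i := i) (b := b 0 i) nN sN _ u.
  rewrite u1 expr1n mulr1 FE; have -> : \sum_j a j * dot (N j u) u =
    \sum_j a j * vector_state x 0 j.
    by apply: eq_bigr => j _; rewrite mxE xE tr.
  by apply => z Kz; rewrite -FE; exact: hF.
have [N' [_ aN _ nE]] := normal_tuple_adjoints nN.
have sq t : 0 <= t -> t <= nrm w * nrm (N i u - b 0 i *: u) ->
    t ^+ 2 <= nrm y ^+ 2 * F (vector_state x).
  move=> t0 ht; apply: le_trans (_ : (nrm w * nrm (N i u - b 0 i *: u)) ^+ 2 <= _).
    by rewrite ler_pXn2r// ?nnegrE// mulr_ge0 ?nrm_ge0.
  by rewrite exprMn wy ler_wpM2l ?sqr_ge0.
split; apply: sq; rewrite ?absc_ge0//.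
  have -> : dot (T i x - b 0 i *: x) y = dot (N i u - b 0 i *: u) w.
    by rewrite !dotBl !dotZl xE yE tr ip.
  by rewrite mulrC; exact: dot_CS.
have -> : dot (T i y - b 0 i *: y) x = dot (N i w - b 0 i *: w) u.
  by rewrite !dotBl !dotZl xE yE tr ip.
exact: adjoint_eigen_bound (aN i) (nE i u).
Qed.

(** [psi] is a state, so it is nonnegative on the positive operator [B + B'], and [B], [B']
    contribute equal real parts. *)
Lemma ucp_Re_ge0 (psi : (H -> H) -> 'M[R[i]]_1) B : ucp psi -> bounded_op B ->
  (forall x, 0 <= rdot (B x) x) -> 0 <= Re (psi B 0 0).
Proof.
move=> [lpsi psi1 cp] bB pB.
have pos A : bounded_op A -> (forall x, 0 <= dot (A x) x) -> 0 <= psi A 0 0.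
  move=> bA pA.
  have pA1 (x : 'I_1 -> H) : 0 <= \sum_i \sum_j dot (A (x j)) (x i).
    by rewrite !big_ord1; exact: pA.
  have := cp 1%N (fun _ _ => A) (fun _ _ => bA) pA1 (fun=> const_mx 1).
  by rewrite !big_ord1 /cdot big_ord1 !mxE big_ord1 !mxE conjcE rmorph1 !mulr1.
have [B' [bB' BB']] := adjoint_exists bB.
have pD A C : bounded_op A -> bounded_op C -> psi (A + C) = psi A + psi C.
  by move=> bA bC; rewrite -{1}[A]scale1r lpsi// scale1r.
have p0 : psi 0 = 0.
  by apply: (addrI (psi 0)); rewrite -pD ?addr0//; exact: bounded0.
have pZ (a : R[i]) A : bounded_op A -> psi (a *: A) = a *: psi A.
  by move=> bA; rewrite -[a *: A]addr0 lpsi ?p0 ?addr0//; exact: bounded0.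
have real A : selfadj A -> Im (psi A 0 0) = 0.
  move=> sA; have [/bounded_opP[lA [C C0 bA]] aA] := sA.
  (* A self-adjoint [A] is the difference of the positive operators [A + C] and [C], so its value
     under [psi] is real. *)
  have bC : bounded_op (C%:C *: @id H) by apply: bounded_scale; exact: bounded_id.
  have aR x : dot (A x) x = (rdot (A x) x)%:C.
    apply: complex_eqP => //; rewrite Im_real.
    have := congr1 (@complex.Im R) (dotC (A x) x); rewrite ImJ -aA; lra.
  have pAC : 0 <= psi (A + C%:C *: id) 0 0.
    apply: pos; first by rewrite -[A]scale1r; apply: bounded_lin => //; exact: sA.1.
    move=> x; rewrite !fctE dotDl dotZl aR dotxx -rmorphM -rmorphD lecR -nrm_sqr.
    have : `|rdot (A x) x| <= C * nrm x * nrm x.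
      apply: le_trans (Re_le_absc _) _; apply: le_trans (dot_CS _ _) _.
      by rewrite ler_wpM2r ?nrm_ge0.
    by rewrite ler_norml => /andP[]; lra.
  have pC : 0 <= psi (C%:C *: id) 0 0.
    apply: pos => // x; rewrite fctE dotZl dotxx -rmorphM lecR.
    by rewrite mulr_ge0 ?rdot_ge0// ltW.
  have := ger0_Im pAC; have := ger0_Im pC; rewrite pD// ?mxE ?ImD; last exact: sA.1.
  by move=> ->; rewrite addr0.
have rB x : dot ((B + B') x) x = (2 * rdot (B x) x)%:C.
  rewrite fctE dotDl (adj_sym BB') [dot x (B x)]dotC.
  by apply: complex_eqP; rewrite ?ReD ?ImD ?ReJ ?ImJ /= /rdot; ring.
have h1 : 0 <= psi (B + B') 0 0.
  apply: pos; first by rewrite -[B]scale1r; exact: bounded_lin.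
  by move=> x; rewrite rB lecR mulr_ge0.
(* [i (B - B')] is self-adjoint; reality of its value means that [psi B] and [psi B'] have the same
   real part. *)
have h2 : Im (psi ('i%C *: B + (- 'i%C) *: B') 0 0) = 0.
  have bi : bounded_op ((- 'i%C) *: B') by exact: bounded_scale.
  apply: real; split; first exact: bounded_lin.
  move=> x y; rewrite !fctE dotDl dotDr !dotZl !dotZr BB' (adj_sym BB').
  have ci : ('i%C : R[i])^* = - 'i%C by apply: complex_eqP; rewrite /= ?oppr0.
  by rewrite rmorphN /= ci opprK addrC.
move: h1 h2; rewrite pD// lpsi//; last exact: bounded_scale.
rewrite pZ// !mxE lecE !ReD !ImD !Im_mul /= => /andP[_ h1] h2; lra.
Qed.

End CompactRange.

(** * Compact tuples *)

Section ScalarRange.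
Variables (R : realType) (d : nat) (K : set 'rV[R[i]]_d).

(** Scalars acting on the one-dimensional space are their own normal dilation, and unital linearity
    allows a character only the value [la]. *)
Lemma scalar_wmin la : K la -> wmin K 1 (fun i => (la 0 i)%:M).
Proof.
move=> Kla; pose L : hilbertType R := complex_line R.
pose N (i : 'I_d) : L -> L := la 0 i *: (@id L).
have dE (x y : L) : dot x y = (x : R[i]) * (y : R[i])^* by [].
exists L, N; split.
- split=> [i|i j].
    split; first by apply: bounded_scale; exact: bounded_id.
    exists ((la 0 i)^* *: (@id L)); split.
    + by apply: bounded_scale; exact: bounded_id.
    + by move=> x y; rewrite !fctE dotZl dotZr conjCK.
    + apply/funext => x; transitivity ((la 0 i * (la 0 i)^*) *: x).
        by rewrite -scalerA.
      by rewrite mulrC -scalerA.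
  apply/funext => x; transitivity ((la 0 i * la 0 j) *: x); first by rewrite -scalerA.
  by rewrite mulrC -scalerA.
- move=> mu [chi [chi1 chil _] chiN]; suff -> : mu = la by [].
  have gid : generated_cstar N id by move=> S [[]].
  have gN i : generated_cstar N (N i) by move=> S [_]; apply; exists i.
  apply/rowP => i; rewrite -chiN.
  have -> : N i = (la 0 i - 1) *: (@id L) + id.
    by apply/funext => x; rewrite !fctE scalerBl scale1r subrK.
  by rewrite chil// chi1 mulr1 subrK.
exists (fun c => c 0 0 : L), (fun z : L => const_mx (z : R[i])); split.
- by move=> a x y; rewrite !mxE.
- by move=> x y; rewrite /cdot big_ord1.
- by move=> x y; rewrite /cdot big_ord1 mxE.
by move=> i x; apply/colP => j; rewrite mul_scalar_mx !mxE ord1.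
Qed.

End ScalarRange.

Section JointEigenvectors.
Variables (R : realType) (H : hilbertType R) (d : nat).
Variables (K : set 'rV[R[i]]_d) (T : 'I_d -> H -> H).
Hypotheses (K_compact : compact K) (K_convex : convex_set K).
Hypothesis T_compact : forall i, compact_op (T i).
Hypothesis T_range : forall n, (0 < n)%N -> matrix_range T n = wmin K n.

Let T_bounded i : bounded_op (T i). Proof. by have [] := T_compact i. Qed.

(** [scalar_wmin] and [T_range] give a state [psi] with value [la] at [T]. If [F] were at least [e]
    at all vector states, the form of [B] below would be nonnegative, and [psi] would give
    [F la >= e]. *)
Lemma state_approximation F la (e : R) : K la -> real_affine F -> F la < e ->
  exists x, nrm x = 1 /\ F (vector_state T x) < e.
Proof.
move=> Kla [a [c FE]] Fe.
have : matrix_range T 1 (fun i => (la 0 i)%:M) by rewrite T_range//; exact: scalar_wmin.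
move=> [psi upsi psiT].
pose B0 : H -> H := \sum_j a j *: T j.
pose B : H -> H := (c - e)%:C *: (@id H) + B0.
have bB0 : bounded_op B0 by apply: bounded_sum => j; exact: bounded_scale.
have bB : bounded_op B by apply: bounded_lin => //; exact: bounded_id.
have rB x : rdot (B x) x = Re (\sum_j a j * dot (T j x) x) + (c - e) * nrm x ^+ 2.
  rewrite nrm_sqr /B fctE rdotDl fctE rdotZl addrC; congr (_ + _).
  by rewrite /B0 fct_sumE /rdot dot_suml; congr Re; apply: eq_bigr => j _; rewrite dotZl.
have [x hx] : exists x, rdot (B x) x < 0.
  apply: contrapT => nx.
  have := @ucp_Re_ge0 _ _ psi B upsi bB.
  have [lpsi psi1 _] := upsi.
  have p0 : psi 0 = 0.
    have := lpsi (-1) 0 0 (bounded0 H) (bounded0 H).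
    by rewrite scaler0 addr0 scaleN1r addNr.
  have pB0 (s : seq 'I_d) : psi (\sum_(j <- s) a j *: T j) = \sum_(j <- s) a j *: psi (T j).
    elim: s => [|j s IHs]; first by rewrite !big_nil.
    by rewrite !big_cons lpsi ?IHs//; apply: bounded_sum => k; exact: bounded_scale.
  rewrite lpsi//; last exact: bounded_id.
  rewrite psi1 pB0 !mxE eqxx mulr1 ReD Re_real summxE.
  have -> : \sum_(j < d) (a j *: psi (T j)) 0 0 = \sum_j a j * la 0 j.
    by apply: eq_bigr => j _; rewrite mxE -psiT mxE eqxx mulr1n.
  have h x : 0 <= rdot (B x) x.
    by rewrite leNgt; apply/negP => ?; apply: nx; exists x.
  by move=> /(_ h); move: Fe; rewrite FE; lra.
have x0 : x != 0 by apply: contraTneq hx => ->; rewrite /rdot dot0r ltxx.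
have nx : 0 < nrm x by rewrite nrm_gt0.
pose y := (nrm x)^-1%:C *: x; have y1 : nrm y = 1 by exact: nrm_unit.
exists y; split=> //; have : rdot (B y) y < 0.
  have [lB _] := (bounded_opP B).1 bB.
  by rewrite /y (linZ lB) rdotZl rdotZr !pmulr_rlt0 ?invr_gt0.
rewrite rB y1 expr1n mulr1 FE.
have -> : \sum_j a j * vector_state T y 0 j = \sum_j a j * dot (T j y) y.
  by apply: eq_bigr => j _; rewrite mxE.
lra.
Qed.

Lemma compact_op_cluster i (x : nat -> H) : (forall n, nrm (x n) <= 1) ->
  exists y, forall e m, 0 < e -> exists2 n, (m <= n)%N & nrm (y - T i (x n)) < e.
Proof.
move=> x1; have [_] := T_compact i; rewrite precompactE => cT.
pose F := (fun n => T i (x n)) @ \oo.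
have FF : ProperFilter F by exact: fmap_proper_filter.
have [|y [_ yc]] := cT F FF.
  apply: (@filterS _ F _ [set T i z | z in [set z | `|z| <= 1]]).
    exact: subset_closure.
  exists 0%N => // n _ /=; exists (x n) => //=.
  by rewrite normE -[1]/(1%:C) lecR.
exists y => e m e0.
have FA : F [set T i (x n) | n in [set n | (m <= n)%N]].
  by exists m => // n /= mn; exists n.
have By : nbhs y (ball y e%:C) by apply: nbhsx_ballx; rewrite ltcR.
have [_ [[n /= mn <-]]] := yc _ _ FA By.
by rewrite -ball_normE /= normE ltcR => h; exists n.
Qed.

Lemma extreme_joint_eigenvalue la : extreme_points K la -> la != 0 -> joint_eigenvalue T la.
Proof.
move=> ela la0; have Kla := ela.1.
have [i lai] : exists i, la 0 i != 0.
  apply: contrapT => h; move/eqP: la0; apply; apply/rowP => i; rewrite mxE.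
  by apply/eqP/negPn/negP => hi; apply: h; exists i.
have /choice[x hx] : forall n : nat, exists x, nrm x = 1 /\
    forall j, nrm (T j x - la 0 j *: x) ^+ 2 <= n.+1%:R^-1.
  move=> n; have e0 : 0 < n.+1%:R^-1 :> R by rewrite invr_gt0 ltr0n.
  have [F [aF hF Fla]] := extreme_quadratic_majorant K_compact K_convex ela e0.
  have [x [x1 Fx]] := state_approximation Kla aF Fla.
  exists x; split=> // j; pose r := T j x - la 0 j *: x.
  (* With the residual [r] itself as test vector, the bound reads [|r|^4 <= |r|^2 F]. *)
  have [+ _] := range_majorant_bound T_bounded T_range j r aF (fun z j Kz => hF z j Kz) x1.
  rewrite -/r dotxx absc_real ger0_norm ?rdot_ge0// -nrm_sqr => h.
  have [->|r0] := eqVneq r 0; first by rewrite nrm0 expr0n ltW.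
  have rp : 0 < nrm r ^+ 2 by rewrite exprn_gt0// nrm_gt0.
  by move: h; rewrite expr2 ler_pM2l// => /le_trans; apply; exact: ltW.
have x1 n : nrm (x n) = 1 by have [] := hx n.
have x1le n : nrm (x n) <= 1 by rewrite x1.
have [y hy] := compact_op_cluster i x1le.
(* [T i (x n)] clusters at [y] and is close to [la_i x n]; as [la_i] is nonzero, [x n] itself
   clusters at [v]. *)
pose v := (la 0 i)^-1 *: y.
have lp : 0 < absc (la 0 i).
  by rewrite -ltcR -normcEabs normr_gt0.
have app e : 0 < e -> exists n, nrm (v - x n) < e /\
    forall j, nrm (T j (x n) - la 0 j *: x n) < e.
  move=> e0; pose e' := Num.min (e / 2 * absc (la 0 i)) e.
  have e'0 : 0 < e' by rewrite lt_min e0 !mulr_gt0.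
  have [|m hm] := @invSn_lt R (e' ^+ 2); first by rewrite exprn_gt0.
  have e4 : 0 < e / 2 * absc (la 0 i) by rewrite !mulr_gt0.
  have [n mn yn] := hy _ m e4; exists n.
  have small j : nrm (T j (x n) - la 0 j *: x n) < e'.
    rewrite -(@ltr_pXn2r _ 2)// ?nnegrE ?nrm_ge0 ?(ltW e'0)//.
    by apply: le_lt_trans ((hx n).2 j) _; exact: hm.
  split; last by move=> j; apply: lt_le_trans (small j) _; rewrite ge_min lexx orbT.
  have -> : v - x n = (la 0 i)^-1 *: ((y - T i (x n)) + (T i (x n) - la 0 i *: x n)).
    by rewrite addrA subrK scalerBr scalerA mulVf// scale1r.
  rewrite nrmZ; have -> : absc (la 0 i)^-1 = (absc (la 0 i))^-1.
    by apply: (@complexI R); rewrite -normcEabs normfV normcEabs fmorphV.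
  rewrite ltr_pdivrMl// mulrC; apply: le_lt_trans (nrmD _ _) _.
  have := lt_le_trans (small i) (_ : e' <= e / 2 * absc (la 0 i)).
  by rewrite ge_min lexx => /(_ isT); lra.
exists v => [|j].
  have [n [h _]] := app 1 ltr01; apply: contraTneq h => ->.
  by rewrite sub0r nrmN x1 ltxx.
have [lT [C C0 bT]] := (bounded_opP (T j)).1 (T_bounded j).
apply/eqP; rewrite -subr_eq0 -nrm_eq0 eq_le nrm_ge0 andbT.
pose M := C + absc (la 0 j) + 1; have M0 : 0 < M.
  by have := absc_ge0 (la 0 j); rewrite /M; lra.
apply/ler_addgt0Pr => e e0; rewrite add0r.
have [n [h1 h2]] := app (e / M) (divr_gt0 e0 M0).
have -> : T j v - la 0 j *: v =
    (T j (v - x n) - la 0 j *: (v - x n)) + (T j (x n) - la 0 j *: x n).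
  by rewrite (linB lT) scalerBr addrACA -opprD !subrK.
apply: le_trans (nrmD _ _) _; apply: le_trans (lerD (nrmD _ _) (ltW (h2 j))) _.
rewrite nrmN nrmZ; have := bT (v - x n) => h3.
have eE : e = M * (e / M) by rewrite mulrCA divff ?mulr1// gt_eqF.
have h4 := ler_wpM2l (absc_ge0 (la 0 j)) (ltW h1).
have h5 := ler_wpM2l (ltW C0) (ltW h1).
have sum_le (t z b q : R) : t <= C * z -> b * z <= b * q -> C * z <= C * q ->
    t + b * z + q <= (C + b + 1) * q by lra.
by rewrite [leRHS]eE; exact: sum_le h3 h4 h5.
Qed.

(** The vector state of [v] is [la] itself, where the majorant [F] can be made arbitrarily small;
    the second estimate of [range_majorant_bound] then forces equality. *)
Lemma extreme_left_eigenvector la v i w : extreme_points K la ->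
  nrm v = 1 -> (forall j, T j v = la 0 j *: v) ->
  dot (T i w) v = la 0 i * dot w v.
Proof.
move=> ela v1 Tv; have vs : vector_state T v = la.
  by apply/rowP => j; rewrite mxE Tv dotZl dotxx -nrm_sqr v1 expr1n mulr1.
apply/eqP; rewrite -dotZl -subr_eq0 -dotBl; set D := dot _ _.
rewrite -normr_eq0 normcEabs eq_complex /= eqxx andbT -[_ == _](@sqrf_eq0 R).
rewrite eq_le sqr_ge0 andbT; apply/ler_addgt0Pr => e e0; rewrite add0r.
have n0 : 0 < nrm w ^+ 2 + 1 by rewrite ltr_wpDl ?sqr_ge0.
have [F [aF hF Fla]] := extreme_quadratic_majorant K_compact K_convex ela (divr_gt0 e0 n0).
have [_] := range_majorant_bound T_bounded T_range i w aF (fun z j Kz => hF z j Kz) v1.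
rewrite -/D vs => /le_trans; apply.
rewrite ltr_pdivlMr// in Fla; have F0 : 0 <= F la.
  by apply: le_trans (hF la i ela.1); exact: sqr_ge0.
by move: Fla; rewrite mulrDr mulr1 mulrC; lra.
Qed.

(* Unit eigenvectors of distinct extreme points are orthogonal, so their images under
   the compact operator [T i] would stay at mutual distance at least [e]. *)
Lemma finite_large_extreme i (e : R) : 0 < e ->
  finite_set [set la | extreme_points K la /\ e <= absc (la 0 i)].
Proof.
move=> e0; apply: contrapT => /infiniteP/pcard_leP/injfunPex[f + finj0]; set A := [set la | _] => fA0.
have fA n : A (f n) by exact: fA0.
have finj n m : n != m -> f n != f m.
  by apply: contra => /eqP h; apply/eqP; apply: (finj0 n m) => //; exact/mem_set.
have /choice[v hv] : forall n, exists v, nrm v = 1 /\ forall j, T j v = f n 0 j *: v.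
  move=> n; have [ef le] := fA n.
  have fn0 : f n != 0.
    by apply: contraTneq le => ->; rewrite mxE absc_real normr0 -ltNge.
  have [w w0 Tw] := extreme_joint_eigenvalue ef fn0.
  exists ((nrm w)^-1%:C *: w); split; first exact: nrm_unit.
  move=> j; have [lT _] := (bounded_opP _).1 (T_bounded j).
  by rewrite (linZ lT) Tw !scalerA mulrC.
have v1 n : nrm (v n) = 1 by have [] := hv n.
have Tv n j : T j (v n) = f n 0 j *: v n by have [_] := hv n.
have vle n : nrm (v n) <= 1 by rewrite v1.
(* [<T_j v_n, v_m>] equals both [la_j <v_n, v_m>] for [la = f n] and the same expression for
   [la = f m]. *)
have orth n m : n != m -> dot (v n) (v m) = 0.
  move=> /finj/eqP nm; apply: contrapT => /eqP d0; apply: nm; apply/rowP => j.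
  apply: (mulIf d0); rewrite -dotZl -Tv.
  exact: extreme_left_eigenvector (fA m).1 (v1 m) (Tv m).
have [y hy] := compact_op_cluster i vle.
have e2 : 0 < e / 2 by rewrite divr_gt0.
have [n _ hn] := hy _ 0%N e2; have [m nm hm] := hy _ n.+1 e2.
(* Pythagoras for orthogonal eigenvectors; but both images lie within [e / 2] of the cluster point
   [y]. *)
have far : e ^+ 2 <= nrm (T i (v n) - T i (v m)) ^+ 2.
  have o : rdot (f n 0 i *: v n) (f m 0 i *: v m) = 0.
    by rewrite /rdot dotZl dotZr orth ?mulr0// neq_ltn nm.
  rewrite !Tv nrm_sqr rdotBl !rdotBr (rdotC (f m 0 i *: v m)) o -!nrm_sqr !nrmZ !v1 !mulr1.
  have := (fA n).2 => h; have := sqr_ge0 (absc (f m 0 i)).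
  have : e ^+ 2 <= absc (f n 0 i) ^+ 2.
    by rewrite ler_pXn2r// ?nnegrE ?absc_ge0 ?(ltW e0).
  lra.
move: far; rewrite ler_pXn2r// ?nnegrE ?nrm_ge0 ?(ltW e0)//; apply/negP; rewrite -ltNge.
have -> : T i (v n) - T i (v m) = (y - T i (v m)) - (y - T i (v n)).
  by rewrite opprB [RHS]addrC addrA subrK.
by apply: le_lt_trans (nrmD _ _) _; rewrite nrmN; lra.
Qed.

Lemma extreme_points_sequence : finite_set (extreme_points K) \/
  exists u : nat -> 'rV[R[i]]_d,
    [/\ injective u, range u = extreme_points K & u @ \oo --> (0 : 'rV[R[i]]_d)].
Proof.
have [fin|inf] := pselect (finite_set (extreme_points K)); [by left|right].
pose B (ik : 'I_d * nat) : set 'rV[R[i]]_d :=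
  [set la | extreme_points K la /\ ik.2.+1%:R^-1 <= absc (la 0 ik.1)].
have finB ik : finite_set (B ik).
  by apply: finite_large_extreme; rewrite invr_gt0 ltr0n.
have cE : countable (extreme_points K).
  (* A nonzero extreme point has some coordinate of modulus at least [1 / (k + 1)]; the index [None]
     accounts for 0. *)
  apply: (@sub_countable _ _ _ (\bigcup_o (if o is Some ik then B ik else [set 0]))).
    apply: subset_card_le => la ela; have [->|la0] := eqVneq la 0.
      by exists None.
    have [i lai] : exists i, la 0 i != 0.
      apply: contrapT => h; move/eqP: la0; apply; apply/rowP => i; rewrite mxE.
      by apply/eqP/negPn/negP => hi; apply: h; exists i.
    have lp : 0 < absc (la 0 i) by rewrite -ltcR -normcEabs normr_gt0.
    have [N hN] := invSn_lt lp.
    by exists (Some (i, N)) => //; split=> //; apply/ltW/hN.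
  apply: bigcup_countable => [|[ik|] _]; first exact: countableP.
    exact: finite_set_countable.
  exact/finite_set_countable/finite_set1.
have /card_set_bijP[u [uE uinj usurj]] : ([set: nat] #= extreme_points K)%card.
  by apply: card_esym; exact: eq_card_nat.
have injU : injective u by move=> n m; apply: uinj; rewrite inE.
have uA n : extreme_points K (u n) by exact: uE.
exists u; split=> //.
  by apply/seteqP; split=> [_ [n _ <-]//|la /usurj].
apply/cvg_ballP => e /gt0_complexE[-> e0].
(* By injectivity of [u], the finitely many extreme points with a large [i]-th coordinate occupy
   finitely many indices. *)
have small i : \forall n \near \oo, absc (u n 0 i) < Re e.
  have fin : finite_set [set n | Re e <= absc (u n 0 i)].
    have -> : [set n | Re e <= absc (u n 0 i)] =
        u @^-1` [set la | extreme_points K la /\ Re e <= absc (la 0 i)].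
      by apply/seteqP; split=> n /=; [move=> h; split|case].
    apply: finite_preimage; first by move=> n m _ _; exact: injU.
    exact: finite_large_extreme.
  have [X XE] := (finite_seqP _).1 fin.
  exists (\max_(n <- X) n).+1 => // n /= Xn; rewrite ltNge; apply/negP => h.
  have nX : n \in X by have : [set` X] n by rewrite -XE.
  by have := @leq_bigmax_seq _ _ xpredT id n nX isT; rewrite leqNgt Xn.
have all_small := @filter_forall nat _ _ \oo _ small.
near=> n; have hn j : absc (u n 0 j) < Re e by move: j; near: n; exact: all_small.
split=> [|i j]; first by rewrite ltcR.
have small_j : `|0 - u n 0 j| < (Re e)%:C by rewrite sub0r normrN normcEabs ltcR.
by rewrite ord1 mxE -ball_normE.
Unshelve. all: by end_near. Qed.

End JointEigenvectors.

Unset Implicit Arguments.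

Theorem theorem3p12 (R : realType) (H : hilbertType R) (d : nat)
    (K : set 'rV[R[i]]_d) (T : 'I_d -> H -> H)
    (K_compact : compact K) (K_convex : convex_set K)
    (T_compact : forall i, compact_op (T i))
    (T_range : forall n : nat, (0 < n)%N -> matrix_range T n = wmin K n) :
  (forall la, extreme_points K la -> la != 0 -> joint_eigenvalue T la) /\
  (finite_set (extreme_points K) \/
   exists u : nat -> 'rV[R[i]]_d,
     [/\ injective u, range u = extreme_points K & u @ \oo --> (0 : 'rV[R[i]]_d)]).
Proof.
split; first exact: (extreme_joint_eigenvalue K_compact K_convex T_compact T_range).
exact: (extreme_points_sequence K_compact K_convex T_compact T_range).
Qed.
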